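(* Let $1<p<\infty$, let $\frac1p+\frac1{p'}=1$, and let $Q_0\subset\mathbb{R}^n$ be a fixed cube. Then: (i) $JN_p(Q_0)\subset GaRo_p(Q_0)$; in fact, for every $f\in JN_p(Q_0)$, $$GaRo_p(f,Q_0)\le 2\,JN_p(f,Q_0).$$ (ii) $GaRo_p(Q_0)=L(p,\infty)(Q_0)$ as sets; in fact, for every $f$ in this set, $$GaRo_p(f,Q_0)\le\frac{2p}{p-1}\|f\|^{*}_{L(p,\infty)},$$ $$\sup_{t>0}t^{1/p}\left(f^{**}(t)-f^*(t)\right)\le 2^{n/p'+1}\,GaRo_p(f,Q_0)+\left(\frac{4}{|Q_0|}\right)^{1/p'}\|f\|_{L^1(Q_0)}.$$
   Context: A cube is a cube in $\mathbb{R}^n$ with sides parallel to the coordinate axes; $|\cdot|$ is Lebesgue measure; $f_Q=\frac1{|Q|}\int_Qf\,dx$. $P(Q_0)$ is the collection of all countable families $\{Q_i\}_{i}$ of subcubes $Q_i\subset Q_0$ with pairwise disjoint interiors. John–Nirenberg spaces: $JN_p(Q_0)=\{f\in L^1(Q_0):JN_p(f,Q_0)<\infty\}$, where $$JN_p(f,Q_0)=\sup_{\{Q_i\}\in P(Q_0)}\left\{\sum_i|Q_i|\left(\frac1{|Q_i|}\int_{Q_i}|f-f_{Q_i}|\,dx\right)^p\right\}^{1/p}.$$ Garsia–Rodemich spaces: $f\in GaRo_p(Q_0)$ if and only if $f\in L^1(Q_0)$ and there is $C>0$ such that for all $\{Q_i\}\in P(Q_0)$, $$\sum_i\frac1{|Q_i|}\int_{Q_i}\int_{Q_i}|f(x)-f(y)|\,dx\,dy\le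 C\left(\sum_i|Q_i|\right)^{1/p'};$$ $GaRo_p(f,Q_0)$ is the infimum of all such $C>0$. With respect to Lebesgue measure on $Q_0$: $\lambda_f(s)=|\{x\in Q_0:|f(x)|>s\}|$, $f^*(t)=\inf\{s\ge0:\lambda_f(s)\le t\}$, $f^{**}(t)=\frac1t\int_0^tf^*(s)\,ds$ for $t>0$. The Marcinkiewicz space $L(p,\infty)(Q_0)$ consists of the measurable $f$ on $Q_0$ with $\|f\|^{*}_{L(p,\infty)}=\sup_{t>0}\{f^*(t)t^{1/p}\}<\infty$. *)

(* Defs.v *)
From HB Require Import structures.
From mathcomp Require Import all_boot all_order all_algebra.
From mathcomp Require Import all_classical all_reals all_analysis.
Import Order.TTheory GRing.Theory Num.Theory.
Import numFieldNormedType.Exports.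

Set Implicit Arguments.
Unset Strict Implicit.
Unset Printing Implicit Defensive.

Local Open Scope classical_set_scope.
Local Open Scope ring_scope.

Section lebesgue_measure_Rn.
Context {R : realType} {n : nat}.

Definition box (a b : 'rV[R]_n) : set 'rV[R]_n :=
  [set x | forall i, a ord0 i <= x ord0 i <= b ord0 i].

(* The truncation at 0 makes the volume of an empty box 0. *)
Definition box_volume (a b : 'rV[R]_n) : R :=
  \prod_(i < n) Num.max 0 (b ord0 i - a ord0 i).

Local Open Scope ereal_scope.

(* Covers are countable families of boxes indexed by an arbitrary D : set nat,
   so that finite covers, and the empty one, are included. *)
Definition lebesgue_outer (A : set 'rV[R]_n) : \bar R :=
  ereal_inf [set s | exists (D : set nat) (a b : nat -> 'rV[R]_n),
    A `<=` \bigcup_(k in D) box (a k) (b k) /\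
    s = \esum_(k in D) (box_volume (a k) (b k))%:E].

Lemma box_volume_ge0 (a b : 'rV[R]_n) : 0 <= (box_volume a b)%:E.
Proof. by rewrite lee_fin prodr_ge0// => i _; rewrite le_max lexx. Qed.

Let outer_ge0 A : 0 <= lebesgue_outer A.
Proof.
apply: le_ereal_inf_tmp => _ [D [a [b [_ ->]]]].
by apply: esum_ge0 => k _; exact: box_volume_ge0.
Qed.

Let outer0 : lebesgue_outer set0 = 0.
Proof.
apply/eqP; rewrite eq_le outer_ge0 andbT; apply: ereal_inf_lbound => /=.
by exists set0, (fun=> 0%R), (fun=> 0%R); split => //; rewrite esum_set0.
Qed.

Let outer_le : {homo lebesgue_outer : A B / A `<=` B >-> A <= B}.
Proof.
move=> A B AB; apply: ereal_inf_le_tmp => _ [D [a [b [BD ->]]]].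
by exists D, a, b; split => //; exact: subset_trans BD.
Qed.

Let outer_sigma_subadditive : sigma_subadditive lebesgue_outer.
Proof.
move=> A; have [[i ioo]|] := pselect (exists i, lebesgue_outer (A i) = +oo).
  rewrite (eseries_pinfty _ _ ioo) ?leey// => k _.
  by rewrite -ltNye (lt_le_trans _ (outer_ge0 _)).
rewrite -forallNE => Aoo.
suff add2e (e : {posnum R}) : lebesgue_outer (\bigcup_n A n) <=
    \sum_(i <oo) lebesgue_outer (A i) + e%:num%:E.
  by apply/lee_addgt0Pr => _/posnumP[].
rewrite (le_trans _ (epsilon_trick _ _ _))//.
pose P k (c : set nat * (nat -> 'rV[R]_n) * (nat -> 'rV[R]_n)) :=
  A k `<=` \bigcup_(j in c.1.1) box (c.1.2 j) (c.2 j) /\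
  \esum_(j in c.1.1) (box_volume (c.1.2 j) (c.2 j))%:E <=
    lebesgue_outer (A k) + (e%:num / (2 ^ k.+1)%:R)%:E.
have [c Pc] : {c & forall k, P k (c k)}.
  apply: (@choice _ _ P) => k; rewrite /P.
  have fA : lebesgue_outer (A k) \is a fin_num.
    by rewrite ge0_fin_numE// ltey; apply/eqP; exact: Aoo.
  have en1 : (0 < e%:num / (2 ^ k.+1)%:R)%R by [].
  have [x [D [a [b [AD ->]]]] /ltW xS] := lb_ereal_inf_adherent en1 fA.
  by exists (D, a, b).
pose K := [set: nat] `*`` (fun k => (c k).1.1).
pose v (p : nat * nat) : \bar R :=
  (box_volume ((c p.1).1.2 p.2) ((c p.1).2 p.2))%:E.
have v0 p : 0 <= v p by exact: box_volume_ge0.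
have /card_esym/ppcard_eqP[f] := card_nat2.
apply: (@le_trans _ _ (\esum_(p in K) v p)); last first.
  rewrite /K -(@esum_esum R _ _ _ _ (fun i j => v (i, j)))//.
  rewrite -nneseries_esumT; last by move=> k; exact: esum_ge0.
  apply: lee_nneseries => k _; last by exact: (Pc k).2.
  by move=> _; exact: esum_ge0.
apply: ereal_inf_lbound => /=.
exists (f @^-1` K), (fun m => (c (f m).1).1.2 (f m).2),
  (fun m => (c (f m).1).2 (f m).2); split.
  move=> x [k _] /(Pc k).1[j Dj xj].
  by exists (f^-1%FUN (k, j)); rewrite /= invK ?inE.
rewrite (@reindex_esum _ _ _ (f @^-1` K) K f)//.
split => //.
- by move=> x y _ _; apply: 'inj_f; rewrite inE.
- by move=> q Kq; exists (f^-1%FUN q); rewrite /= invK ?inE.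
Qed.

HB.instance Definition _ := isOuterMeasure.Build R 'rV[R]_n lebesgue_outer
  outer0 outer_ge0 outer_le outer_sigma_subadditive.

End lebesgue_measure_Rn.

(* 'rV[R]_n with the sigma-algebra of Lebesgue measurable sets, i.e., the sets
   that satisfy the Caratheodory criterion for lebesgue_outer. *)
Notation Rn R n := (caratheodory_type (@lebesgue_outer R n)).

Section spaces.
Context {R : realType} {n : nat}.
Local Open Scope ereal_scope.

Definition lebesgue_Rn : set (Rn R n) -> \bar R := @lebesgue_outer R n.

HB.instance Definition _ := isMeasure.Build _ (Rn R n) R lebesgue_Rn
  (@caratheodory_measure0 _ _ (@lebesgue_outer R n))
  (@caratheodory_measure_ge0 _ _ (@lebesgue_outer R n))
  (@caratheodory_measure_sigma_additive _ _ (@lebesgue_outer R n)).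

(* A function on Q0 is represented by a total function on R^n; nothing below
   depends on its values outside Q0. *)
Local Notation mu := lebesgue_Rn.
Implicit Types (p t s : R) (Q : set 'rV[R]_n) (f : Rn R n -> R).

(* Cubes are closed, with positive side length. *)
Definition is_cube Q : Prop :=
  exists (a : 'rV[R]_n) (l : R), (0 < l)%R /\ Q = box a (a + const_mx l)%R.

(* (Qs i)_(i in D) is an element of P(Q0). *)
Definition cube_family Q0 (D : set nat) (Qs : nat -> set 'rV[R]_n) : Prop :=
  (forall i, D i -> is_cube (Qs i) /\ Qs i `<=` Q0) /\
  trivIset D (fun i => interior (Qs i)).

Definition L1 Q0 : set (Rn R n -> R) := [set f | mu.-integrable Q0 (EFin \o f)].

Definition L1_norm Q0 f : \bar R := \int[mu]_(x in Q0) `|f x|%:E.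

Definition mean f Q : R := ((fine (mu Q))^-1 * \int[mu]_(x in Q) f x)%R.

Definition mean_oscillation f Q : \bar R :=
  (mu Q)^-1 * \int[mu]_(x in Q) `|f x - mean f Q|%:E.

Definition JN_norm p Q0 f : \bar R :=
  ereal_sup [set s | exists D Qs, cube_family Q0 D Qs /\
    s = (\esum_(i in D) (mu (Qs i) * mean_oscillation f (Qs i) `^ p)) `^ p^-1].

Definition JN p Q0 : set (Rn R n -> R) :=
  [set f | L1 Q0 f /\ JN_norm p Q0 f < +oo].

Definition GaRo_bound p Q0 f (C : R) : Prop :=
  let p' := fine (hoelder_conjugate p%:E) in
  forall D Qs, cube_family Q0 D Qs ->
    \esum_(i in D) ((mu (Qs i))^-1 *
      \int[mu]_(y in Qs i) \int[mu]_(x in Qs i) `|f x - f y|%:E)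
    <= C%:E * (\esum_(i in D) mu (Qs i)) `^ p'^-1.

Definition GaRo p Q0 : set (Rn R n -> R) :=
  [set f | L1 Q0 f /\ exists2 C : R, (0 < C)%R & GaRo_bound p Q0 f C].

Definition GaRo_norm p Q0 f : \bar R :=
  ereal_inf [set C%:E | C in [set C : R | (0 < C)%R /\ GaRo_bound p Q0 f C]].

Definition distribution_function Q0 f s : \bar R :=
  mu (Q0 `&` [set x | (s < `|f x|)%R]).

Definition rearrangement Q0 f t : \bar R :=
  ereal_inf [set s%:E | s in
    [set s : R | (0 <= s)%R /\ distribution_function Q0 f s <= t%:E]].

Definition maximal_rearrangement Q0 f t : \bar R :=
  (t^-1)%:E * \int[lebesgue_measure]_(s in `[0%R, t]) rearrangement Q0 f s.

Definition weakL_norm p Q0 f : \bar R :=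
  ereal_sup [set rearrangement Q0 f t * (t `^ p^-1)%:E | t in [set t | 0 < t]%R].

Definition weakL p Q0 : set (Rn R n -> R) :=
  [set f | measurable_fun (Q0 : set (Rn R n)) f /\ weakL_norm p Q0 f < +oo].

End spaces.

(* Main.v *)
From HB Require Import structures.
Require Import Defs.
From mathcomp Require Import all_boot all_order all_algebra.
From mathcomp Require Import all_classical all_reals all_analysis.
From mathcomp Require Import finmap measurable_realfun lra.

(** Both inclusions into the Garsia-Rodemich space start from the triangle
    inequality: the double integral of [|f x - f y|] over a cube [Q] is at most
    [2 |Q|] times the integral of [|f - m|] over [Q], for any constant [m]
    ([double_oscillation_le]). With the mean of [f] for [m], Hoelder's inequality
    for sums ([esum_hoelder]) gives the inclusion of the John-Nirenberg space.
    With [m = 0], the sum over a family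
    of cubes is at most twice the integral of [|f|] over their union, and the
    integral of [|f|] over a set of measure [V] is at most
    [p / (p - 1) * N * V ^ (1 / p')] when [f] has weak norm [N]
    ([integral_weak_le]).

    Conversely, let [f] satisfy the Garsia-Rodemich condition with constant [C],
    let [c >= 0] be such that the set [E] where [|f| > c] has measure at most
    [t <= |Q0| / 2], and decompose [E] into maximal dyadic cubes in which its
    density exceeds [2 ^ -(n + 1)] ([calderon_zygmund]). In each of them [E] has
    density at most 1/2, so that the points of [E] can be paired with at least as
    many points where [|f| <= c]: the integral of the excess [(|f| - c)^+] is at
    most the normalized double integral ([excess_le_double_integral]). Since the
    cubes have total measure at most [2 ^ (n + 1) * t], the excess has integral
    at most [C * (2 ^ (n + 1) * t) ^ (1 / p')] ([GaRo_excess]). On the other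
    hand, the integral of [f^*] from [0] to [t] is at most [c * t] plus the integral
    of the excess ([integral_rearrangement_le]). Taking the infimum over [c]
    yields [t ^ (1 / p) * (f^** t - f^* t) <= 2 ^ ((n + 1) / p') * C] for
    [t < |Q0| / 4], and [(n + 1) / p' <= n / p' + 1]. For larger [t], the
    trivial bound of [f^** t] by the norm of [f] in L^1 divided by [t] accounts
    for the second term of the estimate. Finally
    [f^* t - f^* (2 * t) <= 2 * (f^** (2 * t) - f^* (2 * t))], so that the
    estimate propagates from large to small [t] and bounds the weak norm
    ([weakL_norm_lty]).

    The Lebesgue measure is that of the outer measure defined by covers by boxes.
    That a box has its volume as measure is proved by integrating indicator
    functions one coordinate at a time ([box_volume_le_esum]); the density
    argument behind the decomposition compares dyadic cubes and boxes
    directly. *)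

Set Implicit Arguments.
Unset Strict Implicit.
Unset Printing Implicit Defensive.

Import Order.TTheory GRing.Theory Num.Theory.
Import numFieldNormedType.Exports.

Local Open Scope classical_set_scope.
Local Open Scope ring_scope.
Local Open Scope ereal_scope.

(** * Lebesgue measure of boxes *)

Section lebesgue_measure_of_boxes.
Context {R : realType} {n : nat}.
Implicit Types (a b x : 'rV[R]_n) (A : set 'rV[R]_n).
Local Notation mu1 := (@lebesgue_measure R).

Lemma integral_indic_itvcc (a b c : R) : (0 <= c)%R ->
  \int[mu1]_y (c * \1_(`[a, b]%classic) y)%:E = (c * Num.max 0 (b - a))%:E.
Proof.
move=> c0; under eq_integral do rewrite EFinM.
rewrite ge0_integralZl_EFin//; last first.
- by apply/measurable_EFinP; exact: measurable_indic.
rewrite integral_indic// setIT.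
rewrite [X in _ * X](_ : _ = mu1 `[a, b]%classic)// lebesgue_measure_itv/= lte_fin EFinM; congr (_ * _).
rewrite maxEle; case: ltP => ab.
  by rewrite subr_ge0 (ltW ab) EFinB.
by rewrite subr_ge0; case: leP => // ba; congr EFin; lra.
Qed.

(** The [i]-th factor of the indicator function of a box at the point [x], once
    the coordinates of index smaller than [j] have been integrated out; the
    point is a function so that one coordinate is easily replaced. *)
Definition box_slice (j : nat) (a b : 'rV[R]_n) (x : 'I_n -> R) (i : 'I_n) : R :=
  (if (i < j)%N then Num.max 0 (b ord0 i - a ord0 i)
   else \1_(`[a ord0 i, b ord0 i]%classic) (x i))%R.

Let slice_ge0 j a b (x : 'I_n -> R) i : (0 <= box_slice j a b x i)%R.
Proof. by rewrite /box_slice; case: ifP => // _; rewrite le_max lexx. Qed.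

Let integral_slice j (jn : (j < n)%N) a b (x : 'I_n -> R) (c : R) : (0 <= c)%R ->
  measurable_fun setT (fun y => (c * \prod_i box_slice j a b
     (fun i => if i == Ordinal jn then y else x i) i)%:E) /\
  \int[mu1]_y (c * \prod_i box_slice j a b
     (fun i => if i == Ordinal jn then y else x i) i)%:E =
  (c * \prod_i box_slice j.+1 a b x i)%:E.
Proof.
move=> c0; set j0 := Ordinal jn.
pose C := (c * \prod_(i | i != j0) box_slice j.+1 a b x i)%R.
have E y : (c * \prod_i box_slice j a b (fun i => if i == j0 then y else x i) i =
    C * \1_(`[a ord0 j0, b ord0 j0]%classic) y)%R.
  rewrite (bigD1 j0)//= {1}/box_slice ltnn eqxx mulrA -mulrAC; congr (_ * _ * _)%R.
  apply: eq_bigr => i ij; rewrite /box_slice ltnS (negbTE ij).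
  rewrite (leq_eqVlt i) (_ : (i == j :> nat) = false)//.
  by apply: contra_neqF ij => /eqP ij; exact: val_inj.
have C0 : (0 <= C)%R by rewrite mulr_ge0// prodr_ge0.
under eq_integral do rewrite E.
under eq_fun do rewrite E.
split.
  by apply/measurable_EFinP/measurable_funM => //; exact: measurable_indic.
rewrite integral_indic_itvcc//; congr EFin.
by rewrite (bigD1 j0)//= {1}/box_slice ltnSn mulrA mulrAC.
Qed.

(** A countable cover of a box by boxes has at least the volume of the box: the
    indicator of the box is at most the sum of the indicators of the covering
    boxes, and this inequality can be integrated one coordinate at a time. *)
Lemma box_volume_le_esum (D : set nat) (u v : nat -> 'rV[R]_n) a b :
  box a b `<=` \bigcup_(k in D) box (u k) (v k) ->
  (box_volume a b)%:E <= \esum_(k in D) (box_volume (u k) (v k))%:E.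
Proof.
move=> sub.
pose w k : R := (k \in D)%:R.
have w0 k : (0 <= w k)%R by [].
suff H (j : nat) : (j <= n)%N -> forall x : 'I_n -> R, (\prod_i box_slice j a b x i)%:E <=
    \sum_(k <oo) (w k * \prod_i box_slice j (u k) (v k) x i)%:E.
  have := H n (leqnn n) (fun=> 0%R).
  rewrite /box_slice; under eq_bigr do rewrite ltn_ord.
  move/le_trans; apply; rewrite esum_mkcond nneseries_esumT; last first.
    by move=> k; rewrite lee_fin mulr_ge0// prodr_ge0// => i _; exact: slice_ge0.
  apply: le_esum => k _; rewrite /w; case: ifP => _; last by rewrite mul0r.
  by rewrite mul1r lee_fin; apply: ler_prod => i _; rewrite ltn_ord le_max !lexx.
elim: j => [_ x|j IH jn x].
  have [Bx|nBx] := pselect (box a b (\row_i x i)); last first.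
    have [i ni] : exists i, ~ (a ord0 i <= x i <= b ord0 i)%R.
      apply: contrapT => H; apply: nBx => i; rewrite mxE.
      by apply: contrapT => ?; apply: H; exists i.
    rewrite (bigD1 i)//= {1}/box_slice/= indicE memNset ?mul0r; last by rewrite /= in_itv.
    by apply: nneseries_ge0 => k _ _; rewrite lee_fin mulr_ge0// prodr_ge0// => ? _; exact: slice_ge0.
  have [k Dk xk] := sub _ Bx.
  have -> : (\prod_i box_slice 0 a b x i = w k * \prod_i box_slice 0 (u k) (v k) x i)%R.
    rewrite /w mem_set// mul1r !big1// => i _; rewrite /box_slice/= indicE mem_set//= in_itv/=.
      by have := xk i; rewrite mxE.
    by have := Bx i; rewrite mxE.
  rewrite nneseries_esumT; last first.
    by move=> ?; rewrite lee_fin mulr_ge0// prodr_ge0// => i _; exact: slice_ge0.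
  apply: esum_ge; exists [set k] => //.
  by rewrite fsbig_set1.
have {}IH := IH (ltnW jn).
have [m E] := @integral_slice j jn a b x 1 ler01.
rewrite -[X in X%:E]mul1r -E.
apply: (@le_trans _ _ (\int[mu1]_y \sum_(k <oo) (w k * \prod_i box_slice j (u k) (v k)
   (fun i => if i == Ordinal jn then y else x i) i)%:E)).
  apply: ge0_le_integral => //.
  - by move=> y _; rewrite mul1r lee_fin prodr_ge0// => i _; exact: slice_ge0.
  - apply: ge0_emeasurable_sum.
      by move=> k y _ _; rewrite lee_fin mulr_ge0// prodr_ge0// => i _; exact: slice_ge0.
    by move=> k _; exact: (integral_slice jn _ _ _ (w0 k)).1.
  - by move=> y _; rewrite mul1r; exact: IH.
rewrite integral_nneseries//; last 2 first.
  by move=> k; exact: (integral_slice jn _ _ _ (w0 k)).1.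
  by move=> k y _; rewrite lee_fin mulr_ge0// prodr_ge0// => i _; exact: slice_ge0.
apply: lee_nneseries => k _ ; rewrite (integral_slice jn _ _ _ (w0 k)).2 //.
by rewrite lee_fin mulr_ge0// prodr_ge0// => i _; exact: slice_ge0.
Qed.

Lemma lebesgue_outer_box a b : lebesgue_outer (box a b) = (box_volume a b)%:E.
Proof.
apply/eqP; rewrite eq_le; apply/andP; split.
  apply: ereal_inf_lbound; exists [set 0%N], (fun=> a), (fun=> b); split.
    by move=> x bx; exists 0%N.
  by rewrite esum_set1// box_volume_ge0.
by apply: le_ereal_inf_tmp => _ [D [u [v [sub ->]]]]; exact: box_volume_le_esum.
Qed.

Lemma box_volumeD1 a b i : box_volume a b =
  (Num.max 0 (b ord0 i - a ord0 i) *
   \prod_(j | j != i) Num.max 0 (b ord0 j - a ord0 j))%R.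
Proof. by rewrite /box_volume (bigD1 i). Qed.

(** A half-space cuts every box of a cover into two boxes whose volumes add up
    to the volume of the box. *)
Lemma measurable_halfspace (i : 'I_n) (c : R) :
  measurable ([set x | (x ord0 i <= c)%R] : set (Rn R n)).
Proof.
apply: le_caratheodory_measurable => X.
apply: le_ereal_inf_tmp => _ [D [u [v [sub ->]]]].
pose v' k : 'rV[R]_n := \row_j if j == i then Num.min (v k ord0 i) c else v k ord0 j.
pose u' k : 'rV[R]_n := \row_j if j == i then Num.max (u k ord0 i) c else u k ord0 j.
have -> : \esum_(k in D) (box_volume (u k) (v k))%:E =
    \esum_(k in D) ((box_volume (u k) (v' k))%:E + (box_volume (u' k) (v k))%:E).
  apply: eq_esum => k _; rewrite -EFinD; congr EFin.
  rewrite !(box_volumeD1 _ _ i) !mxE eqxx.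
  rewrite [in RHS](eq_bigr (fun j => Num.max 0 (v k ord0 j - u k ord0 j))%R); last first.
    by move=> j ji; rewrite !mxE (negbTE ji).
  rewrite [X in (_ + _ * X)%R](eq_bigr (fun j => Num.max 0 (v k ord0 j - u k ord0 j))%R); last first.
    by move=> j ji; rewrite !mxE (negbTE ji).
  rewrite -mulrDl; congr (_ * _)%R.
  move: (v k ord0 i) (u k ord0 i) => r s.
  by rewrite /Num.min /Num.max; repeat case: ifPn; rewrite -?leNgt => *; lra.
rewrite esumD; last 2 first.
- by move=> k _; exact: box_volume_ge0.
- by move=> k _; exact: box_volume_ge0.
apply: leeD; apply: ereal_inf_lbound.
- exists D, u, v'; split => // x [Xx /= xc]; have [k Dk xk] := sub _ Xx.
  exists k => // j; have /andP[-> H] := xk j; rewrite mxE; case: eqP => // E.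
  by rewrite le_min -{1}E H E xc.
- exists D, u', v; split => // x [Xx /= xc]; have [k Dk xk] := sub _ Xx.
  exists k => // j; have /andP[H ->] := xk j; rewrite andbT mxE; case: eqP => // E.
  by rewrite ge_max -{1}E H E; move/negP : xc; rewrite -ltNge => /ltW.
Qed.

Lemma measurable_halfspace_ge (i : 'I_n) (c : R) :
  measurable ([set x | (c <= x ord0 i)%R] : set (Rn R n)).
Proof.
rewrite [X in measurable X](_ : _ = \bigcap_(k : nat)
    (~` [set x : 'rV[R]_n | (x ord0 i <= c - k.+1%:R^-1)%R])); last first.
  apply/seteqP; split => x /=.
    by move=> cx k _ /=; apply/negP; rewrite -ltNge (lt_le_trans _ cx)// ltrBlDr ltrDl.
  move=> H; apply/ler_addgt0Pr => e e0.
  have [k ke] : exists k : nat, (k.+1%:R^-1 < e)%R.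
    by have [k _ /(_ k (leqnn k))] := near_infty_natSinv_lt (PosNum e0); exists k.
  have := H k Logic.I; move/negP; rewrite -ltNge ltrBlDr => /ltW/le_trans; apply.
  by rewrite lerD2l ltW.
apply: bigcap_measurable; first by exists 0%N.
by move=> k _; apply: measurableC; exact: measurable_halfspace.
Qed.

Lemma measurable_box a b : measurable (box a b : set (Rn R n)).
Proof.
rewrite (_ : box a b = \bigcap_(i in [set: 'I_n])
   ([set x | (x ord0 i <= b ord0 i)%R] `&` [set x | (a ord0 i <= x ord0 i)%R])).
  apply: fin_bigcap_measurable => // i _.
  by apply: measurableI; [exact: measurable_halfspace|exact: measurable_halfspace_ge].
apply/seteqP; split => x /= H i.
  by have /andP[? ?] := H i.
by have [/= -> ->] := H i Logic.I.
Qed.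

(** The open box with corners [a] and [b]. *)
Definition open_box a b : set 'rV[R]_n :=
  [set x | forall i, (a ord0 i < x ord0 i < b ord0 i)%R].

Lemma measurable_open_box a b : measurable (open_box a b : set (Rn R n)).
Proof.
rewrite (_ : open_box a b = \bigcap_(i in [set: 'I_n])
   (~` [set x | (x ord0 i <= a ord0 i)%R] `&` ~` [set x | (b ord0 i <= x ord0 i)%R])).
  apply: fin_bigcap_measurable => // i _.
  apply: measurableI; apply: measurableC;
    [exact: measurable_halfspace|exact: measurable_halfspace_ge].
apply/seteqP; split => x /= H i.
  by have /andP[? ?] := H i; split; apply/negP; rewrite -ltNge.
by have [/= /negP + /negP] := H i Logic.I; rewrite -!ltNge => -> ->.
Qed.

Lemma lebesgue_box a b : lebesgue_Rn (box a b) = (box_volume a b)%:E.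
Proof. exact: lebesgue_outer_box. Qed.

(** The boundary of a box is covered by its faces, which are degenerate boxes. *)
Lemma lebesgue_box_boundary a b :
  lebesgue_Rn (box a b `\` open_box a b) = 0.
Proof.
apply/eqP; rewrite eq_le measure_ge0 andbT.
pose a' i : 'rV[R]_n := \row_j if j == i then b ord0 i else a ord0 j.
pose b' i : 'rV[R]_n := \row_j if j == i then a ord0 i else b ord0 j.
have mD : measurable (box a b `\` open_box a b : set (Rn R n)).
  by apply: measurableD; [exact: measurable_box|exact: measurable_open_box].
apply: (@le_trans _ _ (\sum_(i < n) (lebesgue_Rn (box (a' i) b) + lebesgue_Rn (box a (b' i))))).
  apply: (@le_trans _ _ (\sum_(i < n) lebesgue_Rn (box (a' i) b `|` box a (b' i)))); last first.
    apply: lee_sum => i _; exact: (measureU2 lebesgue_Rn (measurable_box _ _) (measurable_box _ _)).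
  pose F (k : nat) : set (Rn R n) := if insub k is Some i then box (a' i) b `|` box a (b' i) else set0.
  have := @content_subadditive _ _ _ (@lebesgue_Rn R n) (box a b `\` open_box a b) F n.
  have -> : \sum_(k < n) lebesgue_Rn (F k) = \sum_(i < n) lebesgue_Rn (box (a' i) b `|` box a (b' i)).
    by apply: eq_bigr => i _; rewrite /F valK.
  apply.
  - move=> k _; rewrite /F; case: insub => [i|]//.
    by apply: measurableU; exact: measurable_box.
  - exact: mD.
  - move=> x [Bx nx].
    have [i ni] : exists i, ~ (a ord0 i < x ord0 i < b ord0 i)%R.
      apply: contrapT => H; apply: nx => i.
      by apply: contrapT => ?; apply: H; exists i.
    rewrite -bigcup_mkord; exists i => /=; first exact: ltn_ord.
    rewrite /F valK; have /andP[ax xb] := Bx i.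
    move/negP : ni; rewrite negb_and -!leNgt => /orP[xa|bx]; [right|left] => j;
      rewrite mxE; case: eqP => [->|_] //; have /andP[? ?] := Bx j; apply/andP; split => //.
rewrite big1// => i _; rewrite !lebesgue_box -EFinD !(box_volumeD1 _ _ i) !mxE eqxx !subrr.
by rewrite maxxx !mul0r addr0.
Qed.

End lebesgue_measure_of_boxes.

(** * Families of cubes *)

(** Monotonicity of the integral of nonnegative functions, with no
    measurability assumption. *)
Lemma le_nonneg_integral d (T : measurableType d) (R : realType)
    (mu : {measure set T -> \bar R}) (D : set T) (f g : T -> \bar R) :
  (forall x, D x -> 0 <= f x) -> (forall x, D x -> f x <= g x) ->
  \int[mu]_(x in D) f x <= \int[mu]_(x in D) g x.
Proof.
move=> f0 fg; rewrite !ge0_integralE//; last first.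
  by move=> x Dx; rewrite (le_trans (f0 x Dx))// fg.
apply: ge_ereal_sup => _ /= [h hf <-]; apply: ereal_sup_ubound; exists h => // x.
by rewrite (le_trans (hf x))//; apply: lee_restrict.
Qed.

Section cubes.
Context {R : realType} {n : nat}.
Implicit Types (a b : 'rV[R]_n).
Local Notation mu := (@lebesgue_Rn R n).

Lemma interior_box a b : interior (box a b) = open_box a b.
Proof.
apply/seteqP; split => x.
  move=> /nbhs_ballP[e /= e0 sub] i.
  (* the points x + h and x - h are in the ball, hence in the box *)
  pose h : 'rV[R]_n := const_mx (e / 2)%R.
  have bx (y : 'rV[R]_n) : (forall i, `|x ord0 i - y ord0 i| < e)%R -> box a b y.
    by move=> H; apply: sub; split => // j k; rewrite (ord1 j); exact: H.
  have e2 : (0 < e / 2)%R by rewrite divr_gt0.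
  have e2e : (e / 2 < e)%R by rewrite ltr_pdivrMr// mulr_natr mulr2n ltrDl.
  have /bx/(_ i) : forall i, (`|x ord0 i - (x + h)%R ord0 i| < e)%R.
    by move=> j; rewrite !mxE opprD addrA subrr add0r normrN gtr0_norm.
  have /bx/(_ i) : forall i, (`|x ord0 i - (x - h)%R ord0 i| < e)%R.
    by move=> j; rewrite !mxE opprB addrC subrK gtr0_norm.
  rewrite !mxE => /andP[ax _] /andP[_ xb].
  by rewrite (le_lt_trans ax) ?(lt_le_trans _ xb) ?ltrDl// ltrBlDr ltrDl.
move=> Bx; apply/nbhs_ballP.
pose e := \big[Order.min/1%R]_(i < n) Num.min (x ord0 i - a ord0 i)%R (b ord0 i - x ord0 i)%R.
have e0 : (0 < e)%R.
  rewrite /e; elim/big_ind : _ => //.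
    by move=> u v u0 v0; rewrite lt_min u0.
  by move=> i _; have /andP[? ?] := Bx i; rewrite lt_min !subr_gt0; apply/andP.
exists e => //= y [_ xy] i.
have := xy ord0 i; rewrite /ball/= => H.
have : (e <= Num.min (x ord0 i - a ord0 i) (b ord0 i - x ord0 i))%R.
  by rewrite /e (bigD1 i)//= ge_min lexx.
rewrite le_min => /andP[ea eb].
by move: H; rewrite ltr_norml => /andP[H1 H2]; apply/andP; split; lra.
Qed.

Lemma measurable_cube (Q : set 'rV[R]_n) : is_cube Q -> measurable (Q : set (Rn R n)).
Proof. by move=> [a [l [_ ->]]]; exact: measurable_box. Qed.

Lemma lebesgue_cube a (l : R) : (0 <= l)%R ->
  mu (box a (a + const_mx l)) = (l ^+ n)%:E.
Proof.
move=> l0; rewrite lebesgue_box /box_volume.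
under eq_bigr do rewrite !mxE addrAC subrr add0r max_r//.
by rewrite prodr_const card_ord.
Qed.

Lemma lebesgue_cube_gt0 (Q : set 'rV[R]_n) : is_cube Q ->
  exists2 v : R, (0 < v)%R & mu Q = v%:E.
Proof.
move=> [a [l [l0 ->]]]; exists (l ^+ n)%R; first by rewrite exprn_gt0.
by rewrite lebesgue_cube// ltW.
Qed.

Lemma ge0_integral_interior_box (g : Rn R n -> \bar R) a b :
  measurable_fun (box a b : set (Rn R n)) g -> (forall x, box a b x -> 0 <= g x) ->
  \int[mu]_(x in box a b) g x = \int[mu]_(x in open_box a b) g x.
Proof.
move=> mg g0.
rewrite (ge0_negligible_integral _ _ mg g0 (lebesgue_box_boundary a b)); last 2 first.
- by apply: measurableD; [exact: measurable_box|exact: measurable_open_box].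
- exact: measurable_box.
rewrite setDD setIidr// => x Bx i; have /andP[? ?] := Bx i.
by apply/andP; split; exact: ltW.
Qed.

(** Boxes with disjoint interiors are disjoint up to their boundaries, which are
    null sets. *)
Lemma esum_integral_boxes (T : choiceType) (D : set T) (Q : T -> set 'rV[R]_n)
    (S : set (Rn R n)) (g : Rn R n -> \bar R) :
  (forall i, D i -> (exists a b, Q i = box a b) /\ Q i `<=` S) ->
  trivIset D (fun i => interior (Q i)) ->
  measurable S -> measurable_fun S g -> (forall x, S x -> 0 <= g x) ->
  \esum_(i in D) \int[mu]_(x in Q i) g x <= \int[mu]_(x in S) g x.
Proof.
move=> DQ tQ mS mg g0; apply: ge_ereal_sup => _ [F [finF FD] <-].
(* the value outside of D makes every O i measurable *)
pose O i : set (Rn R n) := if i \in D then interior (Q i) else set0.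
have OS i : O i `<=` S.
  rewrite /O; case: ifPn => [/set_mem Di|_] x //.
  by move=> /interior_subset; exact: (DQ i Di).2.
have mO i : measurable (O i).
  rewrite /O; case: ifPn => [/set_mem Di|_] //; have [[a [b ->]] _] := DQ i Di.
  by rewrite interior_box; exact: measurable_open_box.
rewrite fsbig_finite//=.
have -> : \sum_(i <- fset_set F) \int[mu]_(x in Q i) g x =
    \sum_(i <- fset_set F) \int[mu]_(x in O i) g x.
  rewrite !big_seq; apply: eq_bigr => i; rewrite in_fset_set// => /set_mem Fi.
  have Di := FD _ Fi; have [[a [b Qi]] QS] := DQ i Di.
  rewrite /O mem_set// Qi interior_box ge0_integral_interior_box//.
    apply: measurable_funS mg => //; by rewrite -Qi.
  by rewrite -Qi => x /QS; exact: g0.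
rewrite -ge0_integral_bigsetU//; last 3 first.
- apply/trivIsetP => i j /=; rewrite !in_fset_set// => /set_mem Fi /set_mem Fj ij.
  rewrite /O !mem_set; [|exact: FD..].
  by move/trivIsetP : tQ; apply => //; exact: FD.
- apply: measurable_funS mg => //; rewrite -bigcup_seq => x [i _]; exact: OS.
- by move=> x; rewrite -bigcup_seq => -[i _] /OS; exact: g0.
apply: ge0_subset_integral => //.
- by apply: bigsetU_measurable => i _; exact: mO.
- by rewrite -bigcup_seq => x [i _]; exact: OS.
Qed.

Lemma esum_lebesgue_boxes (T : choiceType) (D : set T) (Q : T -> set 'rV[R]_n)
    (S E : set (Rn R n)) :
  (forall i, D i -> (exists a b, Q i = box a b) /\ Q i `<=` S) ->
  trivIset D (fun i => interior (Q i)) ->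
  measurable S -> measurable E ->
  \esum_(i in D) mu (E `&` Q i) <= mu (E `&` S).
Proof.
move=> DQ tQ mS mE.
have mI : measurable_fun setT (fun x : Rn R n => (\1_E x)%:E : \bar R).
  by apply/measurable_EFinP; exact: measurable_indic.
have I A : measurable A -> \int[mu]_(x in A) (\1_E x)%:E = mu (E `&` A).
  by move=> mA; rewrite integral_indic.
rewrite -I//.
have -> : \esum_(i in D) mu (E `&` Q i) = \esum_(i in D) \int[mu]_(x in Q i) (\1_E x)%:E.
  apply: eq_esum => i /DQ[[a [b ->]] _]; rewrite I//; exact: measurable_box.
apply: esum_integral_boxes => //.
exact: measurable_funTS.
Qed.

End cubes.

Section cube_families.
Context {R : realType} {n : nat}.
Local Notation mu := (@lebesgue_Rn R n).

Lemma cube_family_box (Q0 : set 'rV[R]_n) D Qs : cube_family Q0 D Qs ->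
  forall i : nat, D i -> (exists a b : 'rV[R]_n, Qs i = box a b) /\ Qs i `<=` Q0.
Proof.
by move=> [H _] i /H[[a [l [_ ->]]] s]; split => //; exists a, (a + const_mx l)%R.
Qed.

Lemma esum_lebesgue_family (Q0 : set 'rV[R]_n) D Qs : is_cube Q0 -> cube_family Q0 D Qs ->
  \esum_(i in D) mu (Qs i) <= mu Q0.
Proof.
move=> cQ0 F; have mQ0 := measurable_cube cQ0.
have := @esum_lebesgue_boxes R n _ D Qs Q0 setT (cube_family_box F) F.2 mQ0 measurableT.
by rewrite setTI; under eq_esum do rewrite setTI.
Qed.

End cube_families.

(** * Layer cake formula and rearrangements *)

Lemma nonincreasing_emeasurable (R : realType) (D : set R) (f : R -> \bar R) :
  measurable D -> (forall s t, (s <= t)%R -> f t <= f s) -> measurable_fun D f.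
Proof.
move=> mD fni; apply: (measurability _ (ErealGenCInfty.measurableE R)).
move=> /= _ [_ [r ->] <-]; apply: measurableI => //.
apply: is_interval_measurable => s t /=.
rewrite !in_itv/= !andbT => _ ft u /andP[_ ut].
by rewrite in_itv/= andbT (le_trans ft)// fni.
Qed.

Section layer_cake.
Context d (T : measurableType d) (R : realType).
Variable m : {sigma_finite_measure set T -> \bar R}.
Local Notation mu1 := (@lebesgue_measure R).

Lemma lebesgue_measure_layer (c : R) (y : \bar R) :
  mu1 [set u | (c <= u)%R /\ u%:E < y] = maxe (y - c%:E) 0.
Proof.
case: y => [r| |].
- rewrite (_ : [set u | _] = `[c, r[%classic); last first.
    by apply/seteqP; split => u /=; rewrite in_itv/= lte_fin => /andP.
  rewrite lebesgue_measure_itv/= lte_fin -EFinB maxEge lee_fin.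
  case: ltP => cr; first by rewrite leNgt subr_lt0 ltNge (ltW cr).
  case: ifPn => //; rewrite subr_ge0 => rc; congr EFin; apply/eqP.
  by rewrite eq_sym subr_eq0 eq_le cr rc.
- rewrite (_ : [set u | _] = `[c, +oo[%classic); last first.
    apply/seteqP; split => u /=; rewrite in_itv/= andbT; first by case.
    by split => //; rewrite ltry.
  by rewrite lebesgue_measure_itv/= ltry addye// maxye.
- rewrite (_ : [set u | _] = set0) ?measure0 ?maxNye//.
  by apply/seteqP; split => u //= [].
Qed.

(** Layer cake formula above the level [c]: both sides are the measure of the
    region [c <= u < h x] over [D], by Tonelli's theorem. *)
Lemma layer_cake (D : set T) (h : T -> \bar R) (c : R) :
  measurable D -> measurable_fun D h ->
  \int[m]_(x in D) maxe (h x - c%:E) 0 =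
  \int[mu1]_(u in `[c, +oo[) m (D `&` [set x | u%:E < h x]).
Proof.
move=> mD mh; pose H := h \_ D.
have mH : measurable_fun setT H by exact/(measurable_restrictT _ mD).1.
pose A : set (T * measurableTypeR R) := (D `*` `[c, +oo[%classic) `&`
  [set z | (z.2)%:E < H z.1].
have mA : measurable A.
  apply: measurableI; first by apply: measurableX => //; exact: measurable_itv.
  rewrite -[X in measurable X]setTI; apply: measurable_lte => //.
    by apply/measurable_EFinP; exact: measurable_snd.
  by apply: measurableT_comp => //; exact: measurable_fst.
have xA x : D x -> xsection A x = [set u | (c <= u)%R /\ u%:E < h x].
  move=> Dx; rewrite xsectionE; apply/seteqP; split => u /=.
    by move=> [[_ /=]]; rewrite in_itv/= andbT /H patchE mem_set.
  by move=> [cu hu]; split; [split => //=; rewrite in_itv/= andbT|rewrite /= /H patchE mem_set].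
have xA0 x : ~ D x -> xsection A x = set0.
  by move=> nDx; rewrite xsectionE; apply/seteqP; split => u //= -[[]].
have yA u : (c <= u)%R -> ysection A u = D `&` [set x | u%:E < h x].
  move=> cu; rewrite ysectionE; apply/seteqP; split => x /=.
    by move=> [[/= Dx _]]; rewrite /= /H patchE mem_set.
  by move=> [Dx hu]; split; [split => //=; rewrite in_itv/= andbT|rewrite /= /H patchE mem_set].
have yA0 u : ~ (c <= u)%R -> ysection A u = set0.
  move=> cu; rewrite ysectionE; apply/seteqP; split => x //= [[_ /=]].
  by rewrite in_itv/= andbT.
have := @indic_fubini_tonelli _ _ T (measurableTypeR R) R m mu1 A mA.
rewrite indic_fubini_tonelli_FE// indic_fubini_tonelli_GE// => E.
transitivity (\int[m]_x mu1 (xsection A x)).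
  rewrite integral_mkcond; apply: eq_integral => x _; rewrite patchE.
  case: ifPn => [/set_mem Dx|Dx]; first by rewrite xA// lebesgue_measure_layer.
  by rewrite xA0 ?measure0// => /mem_set; exact/negP.
rewrite [LHS]E [RHS]integral_mkcond; apply: eq_integral => u _; rewrite patchE/=.
case: ifPn => [/set_mem|]; first by rewrite /= in_itv/= andbT => /yA ->.
move=> uc; rewrite yA0 ?measure0// => cu; move/negP : uc; apply.
by apply: mem_set; rewrite /= in_itv/= andbT.
Qed.

End layer_cake.

Section sigma_finite_Rn.
Context {R : realType} {n : nat}.

Lemma sigma_finite_lebesgue_Rn : sigma_finite setT (@lebesgue_Rn R n).
Proof.
exists (fun k => box (const_mx (- k%:R)%R) (const_mx k%:R%R)); last first.
  by move=> k; split; [exact: measurable_box|rewrite lebesgue_box ltry].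
apply/esym/seteqP; split => // x _.
pose M := (\sum_(i < n) `|x ord0 i|)%R.
have [k Mk] : exists k : nat, (M <= k%:R)%R.
  by exists (Num.bound M); rewrite ltW// archi_boundP// sumr_ge0.
exists k => // i; rewrite !mxE -ler_norml (le_trans _ Mk)// /M (bigD1 i)//= lerDl.
by rewrite sumr_ge0.
Qed.

HB.instance Definition _ := Measure_isSigmaFinite.Build _ (Rn R n) R
  (@lebesgue_Rn R n) sigma_finite_lebesgue_Rn.

End sigma_finite_Rn.

Section rearrangements.
Context {R : realType} {n : nat}.
Variables (Q0 : set 'rV[R]_n) (f : Rn R n -> R).
Hypotheses (mQ0 : measurable (Q0 : set (Rn R n)))
  (mf : measurable_fun (Q0 : set (Rn R n)) f).
Local Notation mu := (@lebesgue_Rn R n).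
Local Notation mu1 := (@lebesgue_measure R).
Local Notation lam := (distribution_function Q0 f).
Local Notation fs := (rearrangement Q0 f).

Lemma measurable_abs_gt (A : set (Rn R n)) s : measurable A -> A `<=` Q0 ->
  measurable (A `&` [set x | (s < `|f x|)%R]).
Proof.
move=> mA AQ.
have := @measurable_lte _ (Rn R n) R A mA (fun=> s%:E) (fun x => `|f x|%:E).
rewrite (_ : [set x | s%:E < `|f x|%:E] = [set x | (s < `|f x|)%R]); last first.
  by apply/seteqP; split => x /=; rewrite lte_fin.
apply; first exact: measurable_cst.
apply/measurable_EFinP/measurableT_comp => //.
exact: measurable_funS mf.
Qed.

Lemma distribution_function_noninc s t : (s <= t)%R -> lam t <= lam s.
Proof.
move=> st; apply: le_measure; [exact/mem_set/measurable_abs_gt..|].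
by move=> x [Qx /= tx]; split => //=; rewrite (le_lt_trans st).
Qed.

Lemma distribution_function_le s : lam s <= mu Q0.
Proof. apply: le_measure; [apply/mem_set; exact: measurable_abs_gt|exact: mem_set|].
exact: subIsetl. Qed.

Lemma rearrangement_ge0 t : 0 <= fs t.
Proof. by apply: le_ereal_inf_tmp => _ [s [s0 _] <-]; rewrite lee_fin. Qed.

Lemma rearrangement_noninc s t : (s <= t)%R -> fs t <= fs s.
Proof.
move=> st; apply: ereal_inf_le_tmp => _ [u [u0 us] <-]; exists u => //; split => //.
by rewrite (le_trans us)// lee_fin.
Qed.

Lemma rearrangement_le t s : (0 <= s)%R -> lam s <= t%:E -> fs t <= s%:E.
Proof. by move=> s0 ls; apply: ereal_inf_lbound; exists s. Qed.

(** This is the only relation between the superlevel sets of the rearrangement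
    and the distribution function that the upper bounds on integrals of the
    rearrangement need; no continuity of either function is involved. *)
Lemma lt_rearrangement u t : (0 <= u)%R -> u%:E < fs t -> t%:E < lam u.
Proof.
by move=> u0; rewrite !ltNge; apply: contra => lu; exact: rearrangement_le.
Qed.

Lemma rearrangement_lt s t : fs t < s%:E -> lam s <= t%:E.
Proof.
move=> /ereal_inf_lt[_ [u [u0 ut] <-]]; rewrite lte_fin => us.
by rewrite (le_trans _ ut)// distribution_function_noninc// ltW.
Qed.

(** By the layer cake formula the left-hand side is the integral over [u >= 0] of
    the measure of the [s] in [0, t] such that [fs s > u]; this measure is at
    most [t], and at most the distribution function at [u]. The first bound is
    used for [u < c], the second one for [u >= c]. *)
Lemma integral_rearrangement_le (c t : R) : mu Q0 < +oo -> (0 <= c)%R -> (0 < t)%R ->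
  \int[mu1]_(s in `[0%R, t]) fs s <=
  (c * t)%:E + \int[mu]_(x in Q0) maxe (`|f x|%:E - c%:E) 0.
Proof.
move=> finQ c0 t0.
have mfs D : measurable D -> measurable_fun D fs.
  by move=> mD; apply: nonincreasing_emeasurable => //; exact: rearrangement_noninc.
have maf : measurable_fun (Q0 : set (Rn R n)) (fun x => `|f x|%:E).
  by apply/measurable_EFinP/measurableT_comp.
rewrite (layer_cake mu c mQ0 maf).
have -> : \int[mu1]_(s in `[0%R, t]) fs s =
    \int[mu1]_(s in `[0%R, t]) maxe (fs s - 0%:E) 0.
  by apply: eq_integral => s _; rewrite sube0 max_l// rearrangement_ge0.
have mI : measurable (`[0%R, t]%classic : set (measurableTypeR R)) by exact: measurable_itv.
rewrite (layer_cake (lebesgue_measure : {sigma_finite_measure set (measurableTypeR R) -> \bar R}) 0 mI (mfs _ mI)).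
pose phi u := if (u < c)%R then t%:E else lam u.
have lamE u : mu (Q0 `&` [set x | u%:E < `|f x|%:E]) = lam u.
  by congr mu; apply/seteqP; split => x /= []; rewrite lte_fin.
rewrite [X in _ <= _ + X](_ : _ = \int[mu1]_(u in `[c, +oo[) lam u); last first.
  by apply: eq_integral => u _; exact: lamE.
have lam0 u : 0 <= lam u by exact: measure_ge0.
have phi0 u : 0 <= phi u by rewrite /phi; case: ifP => // _; rewrite lee_fin ltW.
have mlam D : measurable D -> measurable_fun D lam.
  by move=> mD; apply: nonincreasing_emeasurable => //; exact: distribution_function_noninc.
apply: (@le_trans _ _ (\int[mu1]_(u in `[0%R, +oo[) phi u)).
  apply: le_nonneg_integral => [u _|u]; first exact: measure_ge0.
  rewrite /= in_itv/= andbT => u0; rewrite /phi; case: ltP => uc.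
    apply: (@le_trans _ _ (mu1 `[0%R, t]%classic)).
      apply: le_measure; [apply: mem_set|exact: mem_set|exact: subIsetl].
      by apply: measurable_lte => //; exact: mfs.
    by rewrite lebesgue_measure_itv/= lte_fin t0 oppr0 adde0.
  have fl : lam u \is a fin_num.
    by rewrite ge0_fin_numE// (le_lt_trans (distribution_function_le u)).
  have -> : lam u = mu1 `[0%R, fine (lam u)[%classic.
    rewrite lebesgue_measure_itv/= lte_fin oppr0 adde0 fineK//.
    case: ltP => //; rewrite -lee_fin fineK// => l0; apply/eqP.
    by rewrite eq_le l0 lam0.
  apply: le_measure; [apply: mem_set|apply: mem_set; exact: measurable_itv|].
    by apply: measurable_lte => //; exact: mfs.
  move=> s [/=]; rewrite !in_itv/= => /andP[s0 _] us; rewrite s0/=.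
  by rewrite -lte_fin fineK//; exact: lt_rearrangement us.
rewrite (_ : `[0%R, +oo[%classic = `[0%R, c[%classic `|` `[c, +oo[%classic); last first.
  by apply/esym; rewrite -itv_bndbnd_setU// bnd_simp.
have phiE1 : {in `[0%R, c[%classic : set R, phi =1 fun=> t%:E}.
  by move=> u /set_mem/=; rewrite in_itv/= /phi => /andP[_ ->].
have phiE2 : {in `[c, +oo[%classic : set R, phi =1 lam}.
  by move=> u /set_mem/=; rewrite in_itv/= /phi andbT ltNge => ->.
rewrite ge0_integral_setU//; last 2 first.
- apply/measurable_funU => //; split.
    apply: (eq_measurable_fun (fun=> t%:E)); last exact: measurable_cst.
    by move=> u /phiE1.
  apply: (eq_measurable_fun lam); last exact: mlam.
  by move=> u /phiE2.
- rewrite disj_set2E; apply/eqP/seteqP; split => u //=; rewrite !in_itv/= => -[/andP[_ uc]].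
  by rewrite andbT leNgt uc.
apply: leeD; last by rewrite (@eq_integral _ _ _ mu1 _ lam phi).
rewrite (@eq_integral _ _ _ mu1 _ (fun=> t%:E) phi)//.
rewrite integral_cst//= lebesgue_measure_itv/= lte_fin oppr0 adde0 muleC EFinM.
by case: ltP => // c0'; rewrite mul0e mule_ge0// lee_fin// ltW.
Qed.

End rearrangements.

(** * From John-Nirenberg to Garsia-Rodemich *)

Lemma ge0_esumZl_le (R : realType) (T : choiceType) (D : set T) (k : R) (a : T -> \bar R) :
  (0 <= k)%R -> (forall i, D i -> 0 <= a i) ->
  \esum_(i in D) (k%:E * a i) <= k%:E * \esum_(i in D) a i.
Proof.
move=> k0 a0; apply: ge_ereal_sup => _ [F [finF FD] <-].
rewrite fsbig_finite//= big_seq -ge0_sume_distrr; last first.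
  by move=> i; rewrite in_fset_set// => /set_mem/FD/a0.
rewrite lee_wpmul2l ?lee_fin// -big_seq -fsbig_finite//.
by apply: ereal_sup_ubound; exists F.
Qed.

(** Hoelder's inequality for sums, with weights [v] of total mass [V]. *)
Lemma esum_hoelder (R : realType) (T : choiceType) (D : set T) (v : T -> R)
    (o : T -> \bar R) (p q J V : R) :
  (0 < p)%R -> (0 < q)%R -> (p^-1 + q^-1 = 1)%R -> (0 < J)%R ->
  (forall i, D i -> (0 < v i)%R) -> (forall i, D i -> 0 <= o i) ->
  \esum_(i in D) ((v i)%:E * o i `^ p) <= (J `^ p)%:E ->
  \esum_(i in D) (v i)%:E = V%:E ->
  \esum_(i in D) ((v i)%:E * o i) <= (J * V `^ q^-1)%:E.
Proof.
move=> p0 q0 pq J0 v0 o0 HJ HV.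
have [D0|/set0P[i0 Di0]] := eqVneq D set0.
  by rewrite D0 esum_set0 lee_fin mulr_ge0 ?powR_ge0// ltW.
have vV i : D i -> (v i)%:E <= V%:E.
  move=> Di; rewrite -HV; apply: esum_ge; exists [set i].
    by split => // _ ->.
  by rewrite fsbig_set1.
have V0 : (0 < V)%R by rewrite (lt_le_trans (v0 _ Di0))// -lee_fin vV.
(* c is the common value of the o i in the case of equality *)
pose c := (J / V `^ p^-1)%R.
have Vp0 : (0 < V `^ p^-1)%R by rewrite powR_gt0.
have c0 : (0 < c)%R by rewrite divr_gt0.
pose a := (c * (c^-1 `^ p / p))%R.
have a0 : (0 <= a)%R by rewrite mulr_ge0 ?divr_ge0 ?powR_ge0// ltW.
have b0 : (0 <= c / q)%R by rewrite divr_ge0 ?ltW.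
(* Young's inequality t <= t ^ p / p + 1 / q for t = o i / c *)
have young i : D i -> (v i)%:E * o i <= a%:E * ((v i)%:E * o i `^ p) + (c / q)%:E * (v i)%:E.
  move=> Di; have := o0 _ Di; case: (o i) => [r r0| _|//]; last first.
    have -> : a%:E * ((v i)%:E * +oo `^ p) = +oo.
      rewrite poweRyr ?gt_eqF// gt0_muley ?lte_fin ?v0//.
      by rewrite gt0_muley// lte_fin mulr_gt0// divr_gt0// powR_gt0// invr_gt0.
    by rewrite addye ?leey.
  rewrite poweR_EFin -!EFinM -EFinD lee_fin.
  have r0' : (0 <= r)%R by rewrite -lee_fin.
  have := @conjugate_powR R (r / c)%R 1%R p q.
  rewrite divr_ge0 ?(ltW c0)// => /(_ isT ler01 p0 q0 pq).
  rewrite mulr1 powR1 powRM ?invr_ge0 ?(ltW c0)// => Y.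
  have -> : (a * (v i * r `^ p) + c / q * v i =
      v i * (c * (r `^ p * c^-1 `^ p / p + 1 / q)))%R.
    by rewrite /a; move: (c^-1 `^ p)%R (p^-1)%R (q^-1)%R (r `^ p)%R => x y z w; lra.
  rewrite ler_wpM2l ?(ltW (v0 _ Di))//.
  by rewrite -ler_pdivrMl// mulrC.
apply: (@le_trans _ _ (\esum_(i in D) (a%:E * ((v i)%:E * o i `^ p) + (c / q)%:E * (v i)%:E))).
  exact: le_esum.
rewrite esumD; last 2 first.
- by move=> i Di; rewrite !mule_ge0 ?poweR_ge0 ?lee_fin// ltW ?v0.
- by move=> i Di; rewrite mule_ge0 ?lee_fin// ltW ?v0.
apply: (@le_trans _ _ (a%:E * (J `^ p)%:E + (c / q)%:E * V%:E)).
  apply: leeD.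
    apply: le_trans (ge0_esumZl_le a0 _) _; last by rewrite lee_wpmul2l.
    by move=> i Di; rewrite mule_ge0 ?poweR_ge0 ?lee_fin// ltW ?v0.
  apply: le_trans (ge0_esumZl_le b0 _) _; last by rewrite HV.
  by move=> i Di; rewrite lee_fin ltW ?v0.
rewrite -!EFinM -EFinD lee_fin.
have E1 : (c^-1 `^ p * J `^ p = V)%R.
  rewrite -powRM ?invr_ge0 ?(ltW c0) ?(ltW J0)//.
  rewrite /c invf_div mulfVK ?gt_eqF// -powRrM mulVf ?gt_eqF// powRr1//.
  exact: ltW.
have E2 : (c * V = J * V `^ q^-1)%R.
  have -> : (q^-1 = 1 - p^-1)%R by rewrite -pq addrAC subrr add0r.
  rewrite powRB; last by apply/implyP => _; rewrite gt_eqF.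
  by rewrite powRr1 ?(ltW V0)// /c mulrAC mulrA.
have A1 : (a * J `^ p = c * V / p)%R.
  have aux (x y z w : R) : (x * (y * z) * w = x * (y * w) * z)%R by lra.
  by rewrite /a aux E1.
by rewrite A1 (mulrAC c q^-1%R V) -mulrDr pq mulr1 E2.
Qed.

Section oscillation.
Context {R : realType} {n : nat}.
Implicit Types (f : Rn R n -> R).
Local Notation mu := (@lebesgue_Rn R n).

(** Any constant [m] is allowed: the mean of [f] over [Q] is used for the spaces
    of John and Nirenberg, and 0 for the weak spaces. *)
Lemma double_oscillation_le (Q : set 'rV[R]_n) f (m : R) : is_cube Q ->
  measurable_fun (Q : set (Rn R n)) f ->
  (mu Q)^-1 * \int[mu]_(y in Q) \int[mu]_(x in Q) `|f x - f y|%:E <=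
  2%:E * \int[mu]_(x in Q) `|f x - m|%:E.
Proof.
move=> cQ mf; have mQ := measurable_cube cQ.
have [v v0 vE] := lebesgue_cube_gt0 cQ.
set A := \int[mu]_(x in Q) `|f x - m|%:E.
have mfm : measurable_fun (Q : set (Rn R n)) (fun x => `|f x - m|%:E).
  apply/measurable_EFinP; apply: measurableT_comp; first exact: normr_measurable.
  by apply: measurable_funB => //; exact: measurable_cst.
have p0 x : 0 <= `|f x - m|%:E by rewrite lee_fin.
have A0 : 0 <= A by exact: integral_ge0.
have inner y : \int[mu]_(x in Q) `|f x - f y|%:E <= A + v%:E * `|f y - m|%:E.
  apply: (@le_trans _ _ (\int[mu]_(x in Q) (`|f x - m|%:E + `|f y - m|%:E))).
    apply: le_nonneg_integral => x _; first by rewrite lee_fin.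
    by rewrite -EFinD lee_fin (distrC (f y)) ler_distD.
  rewrite (ge0_integralD mu mQ (fun x _ => p0 x) mfm (fun _ _ => p0 y) (measurable_cst _)).
  by rewrite integral_cst//= vE muleC.
apply: (@le_trans _ _ ((mu Q)^-1 * \int[mu]_(y in Q) (A + v%:E * `|f y - m|%:E))).
  rewrite lee_wpmul2l ?inve_ge0//.
  apply: le_nonneg_integral => y _ //.
  by apply: integral_ge0 => x _; rewrite lee_fin.
have vp0 x : Q x -> 0 <= v%:E * `|f x - m|%:E by move=> _; rewrite mule_ge0// lee_fin ltW.
have mvp : measurable_fun (Q : set (Rn R n)) (fun x => v%:E * `|f x - m|%:E).
  exact: measurable_funeM.
rewrite (ge0_integralD mu mQ (fun _ _ => A0) (measurable_cst _) vp0 mvp).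
rewrite integral_cst//= (ge0_integralZl_EFin mu mQ (fun x _ => p0 x) mfm (ltW v0)).
rewrite vE -/A inver gt_eqF// [A * _]muleC -ge0_muleDr// muleA -EFinM mulVf ?gt_eqF//.
rewrite mul1e (_ : 2%:E = 1%:E + 1%:E :> \bar R); last by rewrite -EFinD.
by rewrite ge0_muleDl ?lee_fin// mul1e.
Qed.

End oscillation.

Section JN_to_GaRo.
Context {R : realType} {n : nat}.
Variables (p p' : R) (Q0 : set 'rV[R]_n).
Hypotheses (p1 : (1 < p)%R) (pp' : (p^-1 + p'^-1 = 1)%R) (cQ0 : is_cube Q0).
Local Notation mu := (@lebesgue_Rn R n).

Lemma hoelder_conjugate_gt1 : (1 < p')%R.
Proof.
have p0 : (0 < p)%R by rewrite (lt_trans ltr01).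
have E : (p'^-1 = 1 - p^-1)%R by rewrite -pp' addrAC subrr add0r.
have : (p^-1 < 1)%R by rewrite invf_lt1.
have : (0 < p^-1)%R by rewrite invr_gt0.
move: E => + pi0 pi1; move=> E.
have q0 : (0 < p'^-1)%R by rewrite E subr_gt0.
have p'0 : (0 < p')%R by rewrite -invr_gt0.
by rewrite -invf_lt1// E ltrBlDr ltrDl.
Qed.

Lemma fine_hoelder_conjugate : fine (hoelder_conjugate p%:E) = p'.
Proof.
have p0 : (0 < p)%R by rewrite (lt_trans ltr01).
have := @hoelder_conjugateP R p%:E p'%:E.
have q1 := hoelder_conjugate_gt1.
have q0 : (0 < p')%R by rewrite (lt_trans ltr01).
rewrite !inver !gt_eqF// => /(_ (ltNyr _)).
move=> /(_ isT)[+ _].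
by rewrite -EFinD pp' => <-.
Qed.

Lemma JN_GaRo_bound f (J : R) : L1 Q0 f -> (0 < J)%R -> JN_norm p Q0 f <= J%:E ->
  GaRo_bound p Q0 f (2 * J)%R.
Proof.
move=> fL1 J0 HJ; rewrite /GaRo_bound fine_hoelder_conjugate => D Qs F.
have p0 : (0 < p)%R by rewrite (lt_trans ltr01).
have p'0 : (0 < p')%R by rewrite (lt_trans ltr01)// hoelder_conjugate_gt1.
have mf : measurable_fun (Q0 : set (Rn R n)) f.
  by move/measurable_int : fL1 => /measurable_EFinP.
have cQ i : D i -> is_cube (Qs i) by move=> /(F.1 i)[].
pose v i := fine (mu (Qs i)).
have vE i : D i -> (0 < v i)%R /\ mu (Qs i) = (v i)%:E.
  by move=> /cQ/lebesgue_cube_gt0[w w0 wE]; rewrite /v wE.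
have SV : \esum_(i in D) mu (Qs i) \is a fin_num.
  have [w w0 wE] := lebesgue_cube_gt0 cQ0.
  rewrite ge0_fin_numE; last by apply: esum_ge0.
  by rewrite (le_lt_trans (esum_lebesgue_family cQ0 F))// wE ltry.
set V := fine (\esum_(i in D) mu (Qs i)).
have VE : \esum_(i in D) mu (Qs i) = V%:E by rewrite fineK.
have VE' : \esum_(i in D) (v i)%:E = V%:E.
  by rewrite -VE; apply: eq_esum => i Di; rewrite (vE i Di).2.
rewrite VE poweR_EFin.
have osc0 i : 0 <= mean_oscillation f (Qs i).
  by rewrite mule_ge0 ?inve_ge0// integral_ge0// => x _; rewrite lee_fin.
apply: (@le_trans _ _ (\esum_(i in D) (2%:E * ((v i)%:E * mean_oscillation f (Qs i))))).
  apply: le_esum => i Di; have [v0 E] := vE _ Di.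
  apply: le_trans (double_oscillation_le (mean f (Qs i)) (cQ _ Di) _) _.
    by apply: measurable_funS mf; [exact: measurable_cube|exact: (F.1 i Di).2].
  by rewrite /mean_oscillation E inver gt_eqF// (muleA (v i)%:E) -EFinM divff ?gt_eqF// mul1e.
apply: le_trans (ge0_esumZl_le _ _) _ => //.
  by move=> i Di; rewrite mule_ge0// lee_fin ltW// (vE _ Di).1.
rewrite EFinM -muleA lee_wpmul2l// -EFinM.
apply: (@esum_hoelder _ _ _ _ _ p p') => //; first by move=> i /vE[].
rewrite -[leLHS]poweRe1; last first.
  by apply: esum_ge0 => i Di; rewrite mule_ge0 ?poweR_ge0// lee_fin ltW// (vE _ Di).1.
rewrite -(mulVf (lt0r_neq0 p0)) poweRrM -poweR_EFin.
have H0 : 0 <= \esum_(i in D) ((v i)%:E * mean_oscillation f (Qs i) `^ p).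
  by apply: esum_ge0 => i Di; rewrite mule_ge0 ?poweR_ge0// lee_fin ltW// (vE _ Di).1.
apply: gt0_ler_poweR; rewrite ?in_itv/= ?leey ?poweR_ge0 ?lee_fin ?(ltW J0) ?(ltW p0)//.
apply: le_trans HJ; apply: ereal_sup_ubound; exists D, Qs; split => //.
by congr (_ `^ _); apply: eq_esum => i Di; rewrite (vE _ Di).2.
Qed.

Lemma JN_norm_ge0 f : 0 <= JN_norm p Q0 f.
Proof.
apply: ereal_sup_ubound; exists set0, (fun=> set0); split; first by split => //; apply/trivIsetP.
by rewrite esum_set0 poweR0r// invr_eq0 gt_eqF// (lt_trans ltr01).
Qed.

Lemma GaRo_norm_le f (C : R) : (0 < C)%R -> GaRo_bound p Q0 f C ->
  GaRo_norm p Q0 f <= C%:E.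
Proof. by move=> C0 Cb; apply: ereal_inf_lbound; exists C. Qed.

(** The bound 2 JN + e is used for all e > 0, since the constants in the
    Garsia-Rodemich condition are positive whereas JN may be 0. *)
Lemma JN_sub_GaRo f : JN p Q0 f ->
  GaRo p Q0 f /\ GaRo_norm p Q0 f <= 2%:E * JN_norm p Q0 f.
Proof.
move=> [fL1 Joo]; have J0 := JN_norm_ge0 f.
have fJ : JN_norm p Q0 f \is a fin_num by rewrite ge0_fin_numE.
have fJ0 : (0 <= fine (JN_norm p Q0 f))%R by rewrite -lee_fin fineK.
have H e : (0 < e)%R -> GaRo_bound p Q0 f (2 * (fine (JN_norm p Q0 f) + e))%R.
  move=> e0; apply: JN_GaRo_bound => //; first by rewrite ltr_wpDl.
  by rewrite -[leLHS]fineK// lee_fin lerDl ltW.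
split.
  split => //; exists (2 * (fine (JN_norm p Q0 f) + 1))%R; last exact: H.
  by rewrite mulr_gt0// ltr_wpDl.
apply/lee_addgt0Pr => e e0.
have e2 : (0 < e / 2)%R by rewrite divr_gt0.
rewrite -(fineK fJ) -EFinM -EFinD.
rewrite (_ : _ + e = 2 * (fine (JN_norm p Q0 f) + e / 2))%R; last by lra.
by apply: GaRo_norm_le; [rewrite mulr_gt0// ltr_wpDl|exact: H].
Qed.

End JN_to_GaRo.

(** * From the weak space to Garsia-Rodemich *)

Section weak_type.
Context {R : realType}.
Local Notation mu1 := (@lebesgue_measure R).

Lemma integral_powRN_tail (p s : R) : (1 < p)%R -> (0 < s)%R ->
  \int[mu1]_(u in `[s, +oo[) (u `^ (- p))%:E = (s `^ (1 - p) / (p - 1))%:E.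
Proof.
move=> p1 s0; have p10 : (0 < p - 1)%R by rewrite subr_gt0.
pose F (u : R) := (- (p - 1)^-1 * u `^ (1 - p))%R.
have dF (x : R) : (0 < x)%R -> is_derive x 1%R F (x `^ (- p))%R.
  move=> x0.
  have -> : (x `^ (- p) = - (p - 1)^-1 * ((1 - p) * x `^ (1 - p - 1)))%R.
    rewrite mulrA -(opprB p 1) mulrNN mulVf ?gt_eqF// mul1r; congr (_ `^ _)%R; lra.
  have Z := @is_deriveZ R R^o R^o (fun u : R => u `^ (1 - p))%R (- (p - 1)^-1)%R x 1%R _ (is_derive1_powR (1 - p)%R x0).
  exact: Z.
have cF (x : R) : (0 < x)%R -> {for x, continuous F}.
  by move=> x0; apply/differentiable_continuous/derivable1_diffP; case: (dF _ x0).
have cP (x : R) : (0 < x)%R -> {for x, continuous (fun u : R => u `^ (- p))%R}.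
  move=> x0; apply/differentiable_continuous/derivable1_diffP.
  by apply: derivable_powR; rewrite in_itv/= andbT.
rewrite (@ge0_continuous_FTC2y _ _ F s 0%R).
- by rewrite sub0e /F mulNr EFinN oppeK mulrC.
- by move=> x _; exact: powR_ge0.
- apply/continuous_within_itvcyP; split.
    by move=> x; rewrite in_itv/= andbT => sx; apply: cP; exact: lt_trans sx.
  by apply: cvg_at_right_filter; exact: cP.
- rewrite -[X in _ --> X](mulr0 (- (p - 1)^-1)%R); apply: cvgM; first exact: cvg_cst.
  apply/cvgrPdist_lt => e e0; near=> u.
  have u0 : (0 < u)%R by near: u; exact: nbhs_pinfty_gt.
  rewrite sub0r normrN ger0_norm ?powR_ge0// -(opprB p 1) powRN.
  rewrite invf_plt ?posrE ?powR_gt0//.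
  have ei0 : (0 <= e^-1)%R by rewrite invr_ge0 ltW.
  rewrite [ltLHS](_ : _ = (e^-1 `^ (p - 1)^-1) `^ (p - 1))%R; last first.
    by rewrite -powRrM mulVf ?gt_eqF// powRr1.
  apply: gt0_ltr_powR; rewrite ?nnegrE ?powR_ge0 ?(ltW u0)//.
- by move=> x sx; have [] := dF x (lt_trans s0 sx).
- by apply: cvg_at_right_filter; exact: cF.
- move=> x; rewrite in_itv/= andbT => sx.
  by rewrite derive1E; have /@derive_val -> := dF x (lt_trans s0 sx).
Unshelve. all: by end_near. Qed.

End weak_type.

Section weak_to_GaRo.
Context {R : realType} {n : nat}.
Variables (p p' : R) (Q0 : set 'rV[R]_n).
Hypotheses (p1 : (1 < p)%R) (pp' : (p^-1 + p'^-1 = 1)%R) (cQ0 : is_cube Q0).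
Local Notation mu := (@lebesgue_Rn R n).
Local Notation mu1 := (@lebesgue_measure R).
Variable f : Rn R n -> R.
Hypothesis mf : measurable_fun (Q0 : set (Rn R n)) f.
Variable N : R.
Hypotheses (N0 : (0 < N)%R) (fN : weakL_norm p Q0 f <= N%:E).

Let p0 : (0 < p)%R. Proof. by rewrite (lt_trans ltr01). Qed.

Lemma weak_distribution_function (s : R) : (0 < s)%R ->
  distribution_function Q0 f s <= ((N / s) `^ p)%:E.
Proof.
move=> s0; apply/lee_addgt0Pr => e e0; rewrite -EFinD.
(* t is chosen so that N / t ^ (1/p) < s *)
set t := ((N / s) `^ p + e)%R.
have t0 : (0 < t)%R by rewrite ltr_wpDl// powR_ge0.
apply: rearrangement_lt => //; first exact: measurable_cube.
have tp0 : (0 < t `^ p^-1)%R by rewrite powR_gt0.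
have H : rearrangement Q0 f t * (t `^ p^-1)%:E <= N%:E.
  by apply: le_trans fN; apply: ereal_sup_ubound; exists t.
have Nt : (N / s < t `^ p^-1)%R.
  have Ns : (0 <= N / s)%R by rewrite divr_ge0 ?ltW.
  rewrite -[ltLHS](powRr1 Ns) -(mulfV (lt0r_neq0 p0)) powRrM.
  apply: gt0_ltr_powR; rewrite ?invr_gt0 ?nnegrE ?powR_ge0 ?(ltW t0)//.
  by rewrite ltrDl.
move: H; have := rearrangement_ge0 Q0 f t.
case: (rearrangement Q0 f t) => [r| |] //.
  rewrite !lee_fin !lte_fin => r0 rN.
  have : (r * (N / s) < N \/ r = 0)%R.
    move: r0; rewrite le_eqVlt => /predU1P[->|r0]; first by right.
    by left; rewrite (lt_le_trans _ rN)// ltr_pM2l.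
  case=> [|->//]; rewrite mulrCA gtr_pMr// ltr_pdivrMr// mul1r.
  exact.
by rewrite gt0_mulye ?lte_fin.
Qed.

(** By the layer cake formula, since the part of [E] where [|f| > u] has measure
    at most [mu E] and at most [(N / u) ^ p]. *)
Lemma integral_weak_le (E : set (Rn R n)) : measurable E -> E `<=` Q0 ->
  \int[mu]_(x in E) `|f x|%:E <= (p / (p - 1) * N)%:E * mu E `^ p'^-1.
Proof.
move=> mE EQ; have mQ0 := measurable_cube cQ0.
have p10 : (0 < p - 1)%R by rewrite subr_gt0.
have p'1 := hoelder_conjugate_gt1 p1 pp'.
have p'0 : (0 < p')%R by rewrite (lt_trans ltr01).
have [q q0 QE] := lebesgue_cube_gt0 cQ0.
have fE : mu E \is a fin_num.
  rewrite ge0_fin_numE// (@le_lt_trans _ _ (mu Q0))//; last by rewrite QE ltry.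
  by apply: le_measure => //; exact: mem_set.
have mfE : measurable_fun E (fun x => `|f x|%:E).
  by apply/measurable_EFinP/measurableT_comp => //; exact: measurable_funS mf.
have [E0|En0] := eqVneq (mu E) 0.
  rewrite E0 poweR0r ?invr_eq0 ?gt_eqF// mule0.
  rewrite (ge0_negligible_integral mE mE mfE _ E0); last by move=> x _; rewrite lee_fin.
  by rewrite setDv integral_set0.
have [V V0 VE] : exists2 V : R, (0 < V)%R & mu E = V%:E.
  by exists (fine (mu E)); rewrite ?fineK// -lte_fin fineK// lt0e En0 measure_ge0.
(* s is the level u at which the bounds V and (N / u) ^ p coincide *)
pose s := (N / V `^ p^-1)%R.
have Vp0 : (0 < V `^ p^-1)%R by rewrite powR_gt0.
have s0 : (0 < s)%R by rewrite divr_gt0.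
have -> : \int[mu]_(x in E) `|f x|%:E = \int[mu]_(x in E) maxe (`|f x|%:E - 0%:E) 0.
  by apply: eq_integral => x _; rewrite sube0 max_l// lee_fin.
rewrite (layer_cake mu 0 mE mfE).
pose phi u := if (u < s)%R then V%:E else (N `^ p)%:E * (u `^ (- p))%:E.
have mpow : measurable_fun setT (fun u : R => (u `^ (- p))%:E : \bar R).
  by apply/measurable_EFinP; exact: measurable_powR.
have phi0 u : 0 <= phi u.
  rewrite /phi; case: ifP => _; first by rewrite lee_fin ltW.
  by rewrite -EFinM lee_fin mulr_ge0 ?powR_ge0.
apply: (@le_trans _ _ (\int[mu1]_(u in `[0%R, +oo[) phi u)).
  apply: le_nonneg_integral => [u _|u]; first exact: measure_ge0.
  rewrite /= in_itv/= andbT => u0; rewrite /phi; case: ltP => us.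
    rewrite -VE; apply: le_measure; [apply: mem_set|exact: mem_set|exact: subIsetl].
    by apply: measurable_lte.
  have u0' : (0 < u)%R by rewrite (lt_le_trans s0).
  apply: (@le_trans _ _ (distribution_function Q0 f u)).
    apply: le_measure; [apply: mem_set|apply: mem_set|].
    - by apply: measurable_lte.
    - by apply: measurable_abs_gt (@subset_refl _ _).
    - by move=> x [Ex]; rewrite /= lte_fin => ux; split => //; exact: EQ.
  apply: le_trans (weak_distribution_function u0') _.
  by rewrite powRM ?invr_ge0 ?(ltW N0)// -powR_inv1// -powRrM mulN1r EFinM.
rewrite (_ : `[0%R, +oo[%classic = `[0%R, s[%classic `|` `[s, +oo[%classic); last first.
  by apply/esym; rewrite -itv_bndbnd_setU// bnd_simp// ltW.
have phiE1 : {in `[0%R, s[%classic : set R, phi =1 fun=> V%:E}.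
  by move=> u /set_mem/=; rewrite in_itv/= /phi => /andP[_ ->].
have phiE2 : {in `[s, +oo[%classic : set R, phi =1 fun u => (N `^ p)%:E * (u `^ (- p))%:E}.
  by move=> u /set_mem/=; rewrite in_itv/= /phi andbT ltNge => ->.
rewrite ge0_integral_setU//; last 2 first.
- apply/measurable_funU => //; split.
    apply: (eq_measurable_fun (fun=> V%:E)); last exact: measurable_cst.
    by move=> u /phiE1.
  apply: (eq_measurable_fun (fun u => (N `^ p)%:E * (u `^ (- p))%:E)).
    by move=> u /phiE2.
  by apply: measurable_funeM; exact: measurable_funTS.
- rewrite disj_set2E; apply/eqP/seteqP; split => u //=; rewrite !in_itv/= => -[/andP[_ uc]].
  by rewrite andbT leNgt uc.
rewrite (@eq_integral _ _ _ mu1 _ (fun=> V%:E) phi)//.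
rewrite (@eq_integral _ _ _ mu1 _ (fun u => (N `^ p)%:E * (u `^ (- p))%:E) phi)//.
rewrite ge0_integralZl_EFin ?powR_ge0//; last 2 first.
- by move=> u _; rewrite lee_fin powR_ge0.
- exact: measurable_funTS.
rewrite integral_powRN_tail// integral_cst//= lebesgue_measure_itv/= lte_fin s0 oppr0 adde0.
rewrite VE poweR_EFin -!EFinM -EFinD lee_fin.
have -> : (p'^-1 = 1 - p^-1)%R by rewrite -pp' addrAC subrr add0r.
rewrite (@powRB _ V 1%R); last by apply/implyP => _; rewrite gt_eqF.
rewrite (powRr1 (ltW V0)).
have sp : (s `^ p = N `^ p / V)%R.
  rewrite /s powRM ?invr_ge0 ?(ltW N0) ?(ltW Vp0)// -powR_inv1 ?(ltW Vp0)//.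
  by rewrite -!powRrM mulN1r mulrN mulVf ?gt_eqF// powR_inv1// ltW.
have -> : (N `^ p * (s `^ (1 - p) / (p - 1)) = V * s / (p - 1))%R.
  rewrite powRB; last by apply/implyP => _; rewrite gt_eqF.
  rewrite powRr1 ?(ltW s0)// sp invf_div.
  have Np : (N `^ p != 0)%R by rewrite gt_eqF// powR_gt0.
  have aux (d i x y k : R) : (d * (x * (y * i) * k) = (d * i) * (y * x * k))%R by lra.
  by rewrite aux divff// mul1r.
rewrite (_ : p / (p - 1) * N * (V / V `^ p^-1) = V * s * (p / (p - 1)))%R; last first.
  have aux (x y z w : R) : (x * y * (z * w) = z * (y * w) * x)%R by lra.
  by rewrite aux.
have -> : (p / (p - 1) = 1 + (p - 1)^-1)%R.
  by apply: (mulIf (lt0r_neq0 p10)); rewrite divfK ?mulrDl ?mulVf ?gt_eqF// mul1r subrK.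
by rewrite mulrDr mulr1.
Qed.

Lemma weak_GaRo_bound : GaRo_bound p Q0 f (2 * p / (p - 1) * N)%R.
Proof.
rewrite /GaRo_bound (fine_hoelder_conjugate p1 pp') => D Qs F.
have mQ0 := measurable_cube cQ0.
pose S : set (Rn R n) := \bigcup_(i in D) Qs i.
have mQ i : D i -> measurable (Qs i : set (Rn R n)).
  by move=> Di; apply: measurable_cube; exact: (F.1 i Di).1.
have mS : measurable S by apply: bigcup_measurable => i; exact: mQ.
have SQ : S `<=` Q0 by move=> x [i Di]; exact: (F.1 i Di).2.
have c0 : (0 <= p / (p - 1) * N)%R.
  by rewrite mulr_ge0 ?divr_ge0 ?subr_ge0 ?(ltW p1) ?(ltW p0) ?(ltW N0).
have mfS : measurable_fun S (fun x => `|f x|%:E).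
  by apply/measurable_EFinP/measurableT_comp => //; exact: measurable_funS mf.
apply: (@le_trans _ _ (\esum_(i in D) (2%:E * \int[mu]_(x in Qs i) `|f x|%:E))).
  apply: le_esum => i Di; have [cQi sQi] := F.1 i Di.
  have := double_oscillation_le 0%R cQi (measurable_funS mQ0 sQi mf).
  by under [X in _ <= _ * X -> _]eq_integral do rewrite subr0.
apply: le_trans (ge0_esumZl_le _ _) _ => //.
  by move=> i _; apply: integral_ge0 => x _; rewrite lee_fin.
rewrite (_ : 2 * p / (p - 1) * N = 2 * (p / (p - 1) * N))%R; last by rewrite !mulrA.
rewrite EFinM -muleA lee_wpmul2l//.
apply: (@le_trans _ _ (\int[mu]_(x in S) `|f x|%:E)).
  apply: (esum_integral_boxes _ F.2 mS mfS) => [i Di|x _]; last by rewrite lee_fin.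
  by split; [exact: (cube_family_box F Di).1|move=> x Qx; exists i].
apply: le_trans (integral_weak_le mS SQ) _.
rewrite lee_wpmul2l ?lee_fin//.
have p'0 : (0 < p')%R by rewrite (lt_trans ltr01)// (hoelder_conjugate_gt1 p1 pp').
apply: gt0_ler_poweR; rewrite ?in_itv/= ?leey ?andbT ?measure_ge0 ?esum_ge0//.
  by rewrite invr_ge0 ltW.
pose G i : set (Rn R n) := if i \in D then Qs i else set0.
have -> : \esum_(i in D) mu (Qs i) = \sum_(i <oo) mu (G i).
  rewrite nneseries_esumT// esum_mkcond; apply: eq_esum => i _.
  by rewrite /G; case: ifP => // _; rewrite measure0.
apply: measure_sigma_subadditive => //.
  by move=> i; rewrite /G; case: ifPn => [/set_mem/mQ|_].
by move=> x [i Di Qx]; exists i => //; rewrite /G mem_set.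
Qed.

Lemma weak_L1 : L1 Q0 f.
Proof.
have mQ0 := measurable_cube cQ0.
apply/integrableP; split; first exact/measurable_EFinP.
apply: (@le_lt_trans _ _ ((p / (p - 1) * N)%:E * mu Q0 `^ p'^-1)).
  exact: integral_weak_le.
by have [v v0 ->] := lebesgue_cube_gt0 cQ0; rewrite poweR_EFin -EFinM ltry.
Qed.

End weak_to_GaRo.

(** * Dyadic cubes and Calderon-Zygmund decomposition *)

Section countable_index.
Context {R : realType} {n : nat}.
Local Notation mu := (@lebesgue_Rn R n).

Lemma esum_pickle (T : countType) (D : set T) (a : nat -> \bar R) :
  \esum_(i in choice.pickle @` D) a i = \esum_(t in D) a (choice.pickle t).
Proof.
apply: reindex_esum; split => //; first by move=> x y _ _; exact: pcan_inj choice.pickleK _ _.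
Qed.

Lemma lebesgue_outer_bigcup_nat (D : set nat) (A : nat -> set 'rV[R]_n) :
  mu (\bigcup_(i in D) A i) <= \esum_(i in D) mu (A i).
Proof.
pose G i : set 'rV[R]_n := if i \in D then A i else set0.
apply: (@le_trans _ _ (mu (\bigcup_i G i))).
  apply: le_outer_measure => x [i Di Ax]; exists i => //.
  by rewrite /G mem_set.
apply: le_trans (outer_measure_sigma_subadditive (@lebesgue_outer R n) G) _.
rewrite nneseries_esumT//.
rewrite [leRHS]esum_mkcond; apply: le_esum => i _.
by rewrite /G; case: ifP => // _; rewrite outer_measure0.
Qed.

Lemma lebesgue_outer_bigcup (T : countType) (D : set T) (A : T -> set 'rV[R]_n) :
  mu (\bigcup_(t in D) A t) <= \esum_(t in D) mu (A t).
Proof.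
pose B i : set 'rV[R]_n := if choice.unpickle i is Some t then A t else set0.
have BE t : B (choice.pickle t) = A t by rewrite /B choice.pickleK.
have -> : \bigcup_(t in D) A t = \bigcup_(i in choice.pickle @` D) B i.
  apply/seteqP; split => x.
    by move=> [t Dt Ax]; exists (choice.pickle t); [exists t|rewrite BE].
  by move=> [_ [t Dt <-]]; rewrite BE => Ax; exists t.
apply: le_trans (lebesgue_outer_bigcup_nat _ _) _.
by rewrite esum_pickle; apply: le_esum => t _; rewrite BE.
Qed.

End countable_index.

Section dyadic_cubes.
Context {R : realType} {n : nat}.
Variables (a : 'rV[R]_n) (l : R).
Hypothesis l0 : (0 < l)%R.
Local Notation mu := (@lebesgue_Rn R n).
Local Notation Q0 := (box a (a + const_mx l)%R).
Local Notation index := {ffun 'I_n -> nat}.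

(** Side length of the dyadic cubes of generation [k]. *)
Definition dyadic_side k : R := (l / 2 ^+ k)%R.

(** Lower corner of the dyadic cube of generation [k] at the grid position [j]. *)
Definition dyadic_corner k (j : index) : 'rV[R]_n :=
  (\row_i (a ord0 i + dyadic_side k * (j i)%:R))%R.

(** Dyadic cubes are closed; those of the same generation overlap on their
    boundaries only. *)
Definition dyadic_cube k (j : index) : set 'rV[R]_n :=
  box (dyadic_corner k j) (dyadic_corner k j + const_mx (dyadic_side k))%R.

(** The grid positions of the dyadic subcubes of generation [k] of the root cube. *)
Definition dyadic_valid k (j : index) : Prop := forall i, (j i < 2 ^ k)%N.

(** The position of the dyadic cube [m] generations above. *)
Definition dyadic_ancestor m (j : index) : index := [ffun i => (j i %/ 2 ^ m)%N].

Lemma dyadic_side_gt0 k : (0 < dyadic_side k)%R.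
Proof. by rewrite divr_gt0// exprn_gt0. Qed.

Lemma dyadic_sideD k m : (dyadic_side k = dyadic_side (k + m) * (2 ^ m)%:R)%R.
Proof.
by rewrite /dyadic_side exprD natrX invfM mulrA mulfVK// expf_neq0.
Qed.

Lemma dyadic_cubeP k j x : dyadic_cube k j x <->
  forall i, (a ord0 i + dyadic_side k * (j i)%:R <= x ord0 i <=
    a ord0 i + dyadic_side k * (j i).+1%:R)%R.
Proof.
have E i : (a ord0 i + dyadic_side k * (j i).+1%:R =
   a ord0 i + dyadic_side k * (j i)%:R + dyadic_side k)%R.
  by rewrite -addrA -natr1 mulrDr mulr1.
by split => H i; have := H i; rewrite !mxE E.
Qed.

Lemma is_cube_dyadic k j : is_cube (dyadic_cube k j).
Proof. by exists (dyadic_corner k j), (dyadic_side k); split => //; exact: dyadic_side_gt0. Qed.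

Lemma lebesgue_dyadic k j : mu (dyadic_cube k j) = (dyadic_side k ^+ n)%:E.
Proof. by rewrite lebesgue_cube// ltW// dyadic_side_gt0. Qed.

Lemma dyadic_ancestor_sub k m j :
  dyadic_cube (k + m) j `<=` dyadic_cube k (dyadic_ancestor m j).
Proof.
move=> x /dyadic_cubeP H; apply/dyadic_cubeP => i; have /andP[H1 H2] := H i.
have s0 := ltW (dyadic_side_gt0 (k + m)).
rewrite ffunE (dyadic_sideD k m) -!(mulrA (dyadic_side _)) -!natrM; apply/andP; split.
  apply: le_trans H1; rewrite lerD2l ler_wpM2l// ler_nat mulnC.
  exact: leq_divM.
apply: (le_trans H2); rewrite lerD2l ler_wpM2l// ler_nat mulnC.
by rewrite ltn_ceil// expn_gt0.
Qed.

Lemma dyadic_ancestor_valid k m j : dyadic_valid (k + m) j ->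
  dyadic_valid k (dyadic_ancestor m j).
Proof. by move=> H i; rewrite ffunE ltn_divLR ?expn_gt0// -expnD. Qed.

Lemma dyadic_ancestorD m m' j :
  dyadic_ancestor m' (dyadic_ancestor m j) = dyadic_ancestor (m + m') j.
Proof. by apply/ffunP => i; rewrite !ffunE -divnMA expnD. Qed.

Lemma dyadic_ancestor0 j : dyadic_ancestor 0 j = j.
Proof. by apply/ffunP => i; rewrite !ffunE expn0 divn1. Qed.

Lemma dyadic_cube0 j : dyadic_valid 0 j -> dyadic_cube 0 j = Q0.
Proof.
move=> H; rewrite /dyadic_cube (_ : dyadic_corner 0 j = a); last first.
  apply/rowP => i; rewrite !mxE; have := H i; rewrite expn0 ltnS leqn0 => /eqP ->.
  by rewrite mulr0 addr0.
by rewrite /dyadic_side expr0 divr1.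
Qed.

Lemma dyadic_valid_sub k j : dyadic_valid k j -> dyadic_cube k j `<=` Q0.
Proof.
move=> H; have := @dyadic_ancestor_sub 0 k j; rewrite add0n dyadic_cube0//.
by apply: dyadic_ancestor_valid; rewrite add0n.
Qed.

Lemma dyadic_cover k x : Q0 x -> exists2 j, dyadic_valid k j & dyadic_cube k j x.
Proof.
move=> Q0x; have s0 := dyadic_side_gt0 k.
have H i : exists m : nat, (m < 2 ^ k)%N /\ (a ord0 i + dyadic_side k * m%:R <= x ord0 i <=
    a ord0 i + dyadic_side k * m.+1%:R)%R.
  have := Q0x i; rewrite !mxE => /andP[ax xb].
  pose P m := (x ord0 i <= a ord0 i + dyadic_side k * m.+1%:R)%R.
  have exP : exists m, P m.
    exists (2 ^ k).-1; rewrite /P prednK ?expn_gt0//.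
    by have := dyadic_sideD 0 k; rewrite add0n => <-; rewrite /dyadic_side expr0 divr1.
  have [m Pm min] := ex_minnP exP; exists m; split.
    have := min (2 ^ k).-1; rewrite -ltnS prednK ?expn_gt0//; apply.
    rewrite /P prednK ?expn_gt0//.
    by have := dyadic_sideD 0 k; rewrite add0n => <-; rewrite /dyadic_side expr0 divr1.
  apply/andP; split => //; case: m Pm min => [|m] Pm min; first by rewrite mulr0 addr0.
  rewrite leNgt; apply/negP => xm.
  by have := min m (ltW xm); rewrite ltnn.
have [j jP] := choice H.
exists [ffun i => j i]; first by move=> i; rewrite ffunE; exact: (jP i).1.
by apply/dyadic_cubeP => i; rewrite ffunE; exact: (jP i).2.
Qed.

Lemma dyadic_disjoint k j j' : j <> j' ->
  interior (dyadic_cube k j) `&` interior (dyadic_cube k j') = set0.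
Proof.
move=> jj'; have s0 := dyadic_side_gt0 k.
have [i ij] : exists i, j i <> j' i.
  by apply: contrapT => H; apply: jj'; apply/ffunP => i; apply: contrapT => ?; apply: H; exists i.
apply/seteqP; split => // x []; rewrite !interior_box => /(_ i) + /(_ i).
rewrite !mxE => /andP[H1 H2] /andP[H3 H4].
have aux (p q : nat) : (dyadic_side k * p%:R < dyadic_side k * q%:R + dyadic_side k)%R -> (p <= q)%N.
  by rewrite -[X in (_ < _ + X)%R]mulr1 -mulrDr ltr_pM2l// natr1 ltr_nat ltnS.
apply: ij; apply/eqP; rewrite eqn_leq; apply/andP; split; apply: aux.
  by have := lt_trans H1 H4; rewrite -addrA ltrD2l.
by have := lt_trans H3 H2; rewrite -addrA ltrD2l.
Qed.

Lemma dyadic_trivIset k (J : set index) :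
  trivIset J (fun j => interior (dyadic_cube k j)).
Proof. by apply/trivIsetP => j j' _ _ /eqP jj'; exact: dyadic_disjoint. Qed.

(** The part of a set [N] of small density in all dyadic cubes has small density
    in all boxes: the dyadic cubes of a given generation that meet a box lie in
    a slightly larger box. *)
Lemma dyadic_density_box (N : set 'rV[R]_n) (alpha : R) (u v : 'rV[R]_n) :
  N `<=` Q0 -> (0 <= alpha)%R ->
  (forall k j, dyadic_valid k j ->
    mu (N `&` dyadic_cube k j) <= alpha%:E * mu (dyadic_cube k j)) ->
  mu (N `&` box u v) <= alpha%:E * (box_volume u v)%:E.
Proof.
move=> NQ a0 HN.
pose vol h := box_volume (u - const_mx h)%R (v + const_mx h)%R.
have H k : mu (N `&` box u v) <= alpha%:E * (vol (dyadic_side k))%:E.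
  pose J : set index := [set j | dyadic_valid k j /\ dyadic_cube k j `&` box u v !=set0].
  set h := dyadic_side k.
  have sub : N `&` box u v `<=` \bigcup_(j in J) (N `&` dyadic_cube k j).
    move=> x [Nx Bx]; have [j vj xj] := dyadic_cover k (NQ _ Nx).
    by exists j => //; split => //; exists x.
  have subB j : J j -> dyadic_cube k j `<=` box (u - const_mx h)%R (v + const_mx h)%R.
    move=> [_ [y [/dyadic_cubeP yj yB]]] x /dyadic_cubeP xj i.
    rewrite !mxE; have /andP[y1 y2] := yj i; have /andP[x1 x2] := xj i.
    have /andP[b1 b2] := yB i; move: y2 x2; rewrite -natr1 mulrDr mulr1 -/h => y2 x2.
    rewrite -/h in y1 x1; by apply/andP; split; lra.
  apply: (le_trans (le_outer_measure (@lebesgue_outer R n) _ _ sub)).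
  apply: (le_trans (lebesgue_outer_bigcup _ _)).
  apply: (@le_trans _ _ (\esum_(j in J) (alpha%:E * mu (dyadic_cube k j)))).
    by apply: le_esum => j [vj _]; exact: HN.
  apply: (le_trans (ge0_esumZl_le a0 _)) => //.
  rewrite lee_wpmul2l// -lebesgue_box.
  have := @esum_lebesgue_boxes R n _ J (dyadic_cube k) (box (u - const_mx h)%R (v + const_mx h)%R) setT _ (@dyadic_trivIset k J) (measurable_box _ _) measurableT.
  rewrite setTI; under eq_esum do rewrite setTI; apply.
  by move=> j Jj; split; [do 2 eexists|exact: subB].
have volc : continuous vol.
  apply: (@continuous_big R 'I_n *%R 1%R xpredT (@mul_continuous R) R) => i _ h.
  pose g (h : R) : R^o := ((v + const_mx h) ord0 i - (u - const_mx h) ord0 i)%R.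
  suff cg : {for h, continuous g}.
    exact: (@continuous_max R R (fun=> 0%R) g h (cvg_cst _) cg).
  have -> : g = (fun h => (v ord0 i + h - (u ord0 i - h))%R : R^o).
    by apply/funext => x; rewrite /g !mxE.
  apply: cvgB; apply: cvgD; try exact: cvg_cst; first exact: cvg_id.
  by apply: cvgN; exact: cvg_id.
have vol0 : vol 0%R = box_volume u v.
  by rewrite /vol; congr box_volume; apply/rowP => i; rewrite !mxE ?subr0 ?addr0.
apply/lee_addgt0Pr => e e0.
(* alpha may be 0 *)
pose e' := (e / (alpha + 1))%R.
have e'0 : (0 < e')%R by rewrite divr_gt0// ltr_wpDl.
have [d d0 Hd] : exists2 d : R, (0 < d)%R & forall h, (`|h| < d)%R -> (vol h < box_volume u v + e')%R.
  have /cvgrPdist_lt := volc 0%R => /(_ e' e'0) /nbhs_ballP[d /= d0 Hd]; exists d => // h hd.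
  have := Hd h; rewrite /ball/= sub0r normrN => /(_ hd); rewrite vol0.
  by rewrite ltr_norml => /andP[+ _]; lra.
have [k kd] : exists k, (dyadic_side k < d)%R.
  exists (Num.bound (l / d)); rewrite /dyadic_side ltr_pdivrMr ?exprn_gt0//.
  rewrite mulrC -ltr_pdivrMr//; apply: (@lt_trans _ _ (Num.bound (l / d))%:R).
    by rewrite archi_boundP// divr_ge0 ?ltW.
  by rewrite -natrX ltr_nat ltn_expl.
apply: (le_trans (H k)); rewrite -!EFinM -EFinD lee_fin.
apply: (@le_trans _ _ (alpha * (box_volume u v + e'))%R).
  rewrite ler_wpM2l// ltW// Hd// ger0_norm// ltW//; exact: dyadic_side_gt0.
rewrite mulrDr lerD2l /e' mulrA ler_pdivrMr ?ltr_wpDl//.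
by rewrite mulrC ler_wpM2l ?ltW// ltrDl.
Qed.

(** A form of the Lebesgue density theorem for dyadic cubes: a set of density at
    most [alpha < 1] in every dyadic cube has measure at most [alpha] times the
    volume of any of its covers by boxes. *)
Lemma dyadic_density_eq0 (N : set 'rV[R]_n) (alpha : R) :
  N `<=` Q0 -> (0 < alpha < 1)%R ->
  (forall k j, dyadic_valid k j ->
    mu (N `&` dyadic_cube k j) <= alpha%:E * mu (dyadic_cube k j)) ->
  mu N = 0.
Proof.
move=> NQ /andP[a0 a1] HN.
have N0 : 0 <= mu N by exact: outer_measure_ge0.
have fN : mu N \is a fin_num.
  rewrite ge0_fin_numE// (@le_lt_trans _ _ (mu Q0))//.
    exact: (le_outer_measure (@lebesgue_outer R n)).
  by rewrite lebesgue_box ltry.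
apply/eqP; rewrite eq_le N0 andbT leNgt; apply/negP => Npos.
have r0 : (0 < fine (mu N))%R by rewrite -lte_fin fineK.
have : mu N < (fine (mu N) / alpha)%:E.
  by rewrite -[ltLHS]fineK// lte_fin ltr_pdivlMr// gtr_pMr.
move=> /ereal_inf_lt[_ [D [u [v [sub ->]]]]]; apply/negP; rewrite -leNgt.
have cov : N = \bigcup_(k in D) (N `&` box (u k) (v k)).
  apply/seteqP; split => x; last by move=> [k _ []].
  by move=> Nx; have [k Dk xk] := sub _ Nx; exists k.
have : mu N <= alpha%:E * \esum_(k in D) (box_volume (u k) (v k))%:E.
  rewrite cov; apply: (le_trans (lebesgue_outer_bigcup_nat _ _)).
  apply: (@le_trans _ _ (\esum_(k in D) (alpha%:E * (box_volume (u k) (v k))%:E))).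
    by apply: le_esum => k _; apply: dyadic_density_box => //; exact: ltW.
  apply: ge0_esumZl_le; first exact: ltW.
  by move=> k _; exact: box_volume_ge0.
by rewrite -[in X in X -> _](fineK fN) EFinM -lee_pdivrMl// -EFinM mulrC.
Qed.

Section stopping_cubes.
Variable E : set (Rn R n).
Hypotheses (EQ : E `<=` Q0) (smallE : mu E <= (2^-1)%:E * mu Q0).

Let alpha : R := (2 ^- n.+1)%R.

(** [E] has density larger than 2^-(n+1) in the dyadic cube. *)
Definition dyadic_dense k (j : index) : Prop :=
  alpha%:E * mu (dyadic_cube k j) < mu (E `&` dyadic_cube k j).

(** The maximal dyadic cubes in which [E] has density larger than 2^-(n+1). *)
Definition dyadic_stopping : set (nat * index) :=
  [set kj | [/\ dyadic_valid kj.1 kj.2, dyadic_dense kj.1 kj.2 &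
    forall m, (m < kj.1)%N -> ~ dyadic_dense m (dyadic_ancestor (kj.1 - m) kj.2)]].

Lemma dyadic_dense_stopping k j x : dyadic_valid k j -> dyadic_cube k j x ->
  dyadic_dense k j -> exists2 t, dyadic_stopping t & dyadic_cube t.1 t.2 x.
Proof.
move=> vj xj dj.
pose P m := `[< (m <= k)%N /\ dyadic_dense m (dyadic_ancestor (k - m) j) >].
have exP : exists m, P m.
  by exists k; apply/asboolP; rewrite subnn dyadic_ancestor0.
have [m /asboolP[mk dm] min] := ex_minnP exP.
have km : (m + (k - m) = k)%N by rewrite subnKC.
exists (m, dyadic_ancestor (k - m) j); last first.
  by apply: dyadic_ancestor_sub; rewrite km.
split => //=.
  by apply: dyadic_ancestor_valid; rewrite km.
move=> m' m'm; rewrite dyadic_ancestorD => d'.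
have : P m'.
  apply/asboolP; split; first by rewrite (leq_trans (ltnW m'm)).
  by move: d'; rewrite (_ : k - m + (m - m') = k - m')%N// addnBA ?subnK// ltnW.
by move=> /min; rewrite leqNgt m'm.
Qed.

Lemma dyadic_stopping_trivIset :
  trivIset dyadic_stopping (fun t => interior (dyadic_cube t.1 t.2)).
Proof.
apply/trivIsetP => t t'.
wlog tt' : t t' / (t.1 <= t'.1)%N.
  move=> H st st' ne; have [le|/ltnW le] := leqP t.1 t'.1; first exact: H.
  by rewrite setIC; apply: H => //; rewrite eq_sym.
case: t t' tt' => [k j] [k' j'] /= kk' [/= vj dj sj] [/= vj' dj' sj'] /eqP ne.
have E1 : (k + (k' - k) = k')%N by rewrite subnKC.
have ne' : j <> dyadic_ancestor (k' - k) j'.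
  move=> jE; have [lt|eq] : (k < k')%N \/ k = k'.
  - by move: kk'; rewrite leq_eqVlt => /predU1P[->|]; [right|left].
  - by apply: (sj' k lt); rewrite -jE.
  - by apply: ne; rewrite jE eq subnn dyadic_ancestor0.
apply/seteqP; split => // x [xj xj'].
rewrite -(dyadic_disjoint k ne'); split => //.
apply: interiorS xj'; have := @dyadic_ancestor_sub k (k' - k) j'; by rewrite E1.
Qed.

(** The cube itself is dense but its parent, which is 2^n times as large, is not;
    the root cube is covered by the hypothesis on [E]. *)
Lemma dyadic_stopping_half t : dyadic_stopping t ->
  mu (E `&` dyadic_cube t.1 t.2) <= (2^-1)%:E * mu (dyadic_cube t.1 t.2).
Proof.
case: t => [[|k] j] [/= vj dj sj].
  apply: (le_trans _ (le_trans smallE _)); last by rewrite dyadic_cube0.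
  exact: (le_outer_measure (@lebesgue_outer R n)).
have := sj k (ltnSn k); rewrite subSnn => /negP; rewrite -leNgt => H.
have sub := @dyadic_ancestor_sub k 1 j; rewrite addn1 in sub.
apply: (@le_trans _ _ (mu (E `&` dyadic_cube k (dyadic_ancestor 1 j)))).
  by apply: (le_outer_measure (@lebesgue_outer R n)); exact: setIS.
apply: (le_trans H); rewrite !lebesgue_dyadic -!EFinM lee_fin.
rewrite (dyadic_sideD k 1) addn1 exprMn expn1 /alpha exprSr invfM mulrCA.
have aux (s x h y : R) : (s * (x * h * y) = (x * y) * (h * s))%R by lra.
by rewrite aux mulVf ?mul1r// expf_neq0.
Qed.

(** Calderon-Zygmund decomposition of a set: up to a null set it is covered by
    cubes in which its density is at least 2^-(n+1) and at most 1/2. *)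
Lemma calderon_zygmund : exists D Qs,
  [/\ cube_family Q0 D Qs,
   forall i, D i -> mu (E `&` Qs i) <= (2^-1)%:E * mu (Qs i),
   forall i, D i -> mu (Qs i) <= (2 ^+ n.+1)%:E * mu (E `&` Qs i) &
   mu (E `\` \bigcup_(i in D) Qs i) = 0].
Proof.
pose Qs i : set 'rV[R]_n :=
  if (choice.unpickle i : option (nat * index)) is Some t then dyadic_cube t.1 t.2 else set0.
have QE t : Qs (choice.pickle t) = dyadic_cube t.1 t.2 by rewrite /Qs choice.pickleK.
exists (choice.pickle @` dyadic_stopping), Qs; split.
- split.
    move=> _ [t st <-]; rewrite QE; split; first exact: is_cube_dyadic.
    by apply: dyadic_valid_sub; case: st.
  apply/trivIsetP => _ _ [t st <-] [t' st' <-] tt'; rewrite !QE.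
  move/trivIsetP : dyadic_stopping_trivIset; apply => //.
  by apply: contraNneq tt' => ->.
- by move=> _ [t st <-]; rewrite QE; exact: dyadic_stopping_half.
- move=> _ [t [_ dt _] <-]; rewrite QE.
  rewrite -lee_pdivrMl ?exprn_gt0//; exact: ltW.
- set U := \bigcup_(i in _) _.
  apply: (@dyadic_density_eq0 _ alpha); first by move=> x [Ex _]; exact: EQ.
    by rewrite /alpha invr_gt0 exprn_gt0//= invf_lt1 ?exprn_gt0// exprn_egt1// ltr1n.
  move=> k j vj.
  have [[x [[Ex Ux] xj]]|nx] := pselect ((E `\` U) `&` dyadic_cube k j !=set0); last first.
    have -> : (E `\` U) `&` dyadic_cube k j = set0.
      by apply: contrapT => /eqP/set0P.
    by rewrite measure0 mule_ge0// lee_fin invr_ge0 exprn_ge0.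
  apply: (@le_trans _ _ (mu (E `&` dyadic_cube k j))).
    by apply: (le_outer_measure (@lebesgue_outer R n)); apply: setSI => y [].
  rewrite leNgt; apply/negP => dj; apply: Ux.
  have [t st xt] := dyadic_dense_stopping vj xj dj.
  by exists (choice.pickle t); [exists t|rewrite QE].
Qed.

End stopping_cubes.

End dyadic_cubes.

(** * The Garsia-Rodemich condition controls the excess over a level *)

Section excess.
Context {R : realType} {n : nat}.
Variables (p p' : R) (Q0 : set 'rV[R]_n).
Hypotheses (p1 : (1 < p)%R) (pp' : (p^-1 + p'^-1 = 1)%R) (cQ0 : is_cube Q0).
Local Notation mu := (@lebesgue_Rn R n).
Variable f : Rn R n -> R.
Hypothesis mf : measurable_fun (Q0 : set (Rn R n)) f.

(** If [|f| <= c] on at least half of a cube, the integral over the cube of the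
    excess of [|f|] over [c] is at most the normalized double integral: pair the
    points of the cube where [|f| > c] with those where [|f| <= c]. *)
Lemma excess_le_double_integral (Q : set 'rV[R]_n) (c : R) :
  is_cube Q -> Q `<=` Q0 -> (0 <= c)%R ->
  mu ((Q0 `&` [set x | (c < `|f x|)%R]) `&` Q) <= (2^-1)%:E * mu Q ->
  \int[mu]_(x in Q) maxe (`|f x|%:E - c%:E) 0 <=
  (mu Q)^-1 * \int[mu]_(y in Q) \int[mu]_(x in Q) `|f x - f y|%:E.
Proof.
move=> cQ sQ c0; set E := Q0 `&` _ => half.
have mQ := measurable_cube cQ; have mQ0 := measurable_cube cQ0.
have mE : measurable (E : set (Rn R n)) by exact: measurable_abs_gt (@subset_refl _ _).
have [v v0 vE] := lebesgue_cube_gt0 cQ.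
pose g (x : Rn R n) : \bar R := maxe (`|f x|%:E - c%:E) 0.
have g0 x : 0 <= g x by rewrite /g le_max lexx orbT.
have gE x : (c < `|f x|)%R -> g x = (`|f x| - c)%:E.
  by move=> cx; rewrite /g -EFinB max_l// lee_fin subr_ge0 ltW.
have gE0 x : ~ (c < `|f x|)%R -> g x = 0.
  by move=> /negP; rewrite -leNgt => cx; rewrite /g -EFinB max_r// lee_fin subr_le0.
have mfQ : measurable_fun (Q : set (Rn R n)) f by exact: measurable_funS mf.
have mg : measurable_fun (Q : set (Rn R n)) g.
  apply: measurable_maxe; last exact: measurable_cst.
  apply: emeasurable_funB; last exact: measurable_cst.
  by apply/measurable_EFinP; apply: measurableT_comp mfQ; exact: normr_measurable.
set B := Q `\` E.
have mB : measurable (B : set (Rn R n)) by exact: measurableD.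
have [b b0 bE] : exists2 b : R, (v / 2 <= b)%R & mu B = b%:E.
  have EB : mu Q = mu B + mu (Q `&` E) by exact: measureDI.
  have fB : mu B \is a fin_num.
    rewrite ge0_fin_numE// (@le_lt_trans _ _ (mu Q))//; last by rewrite vE ltry.
    by rewrite EB leeDl.
  exists (fine (mu B)); last by rewrite fineK.
  rewrite -lee_fin fineK//; move: half; rewrite setIC vE => half.
  have : v%:E <= mu B + (v / 2)%:E.
    by rewrite -vE EB leeD2l// (le_trans half)// -EFinM mulrC.
  by rewrite -leeBlDr// -EFinB; congr (_%:E <= _); lra.
set I := \int[mu]_(x in Q) g x.
have I0 : 0 <= I by apply: integral_ge0.
(* for y in B = Q minus E, the inner integral over all x in Q is at least I, and
   for y in E, the inner integral over x in B alone is at least b * g y *)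
have inner y : Q y -> b%:E * g y + I * (\1_B y)%:E <= \int[mu]_(x in Q) `|f x - f y|%:E.
  move=> Qy; have [cy|ncy] := pselect (c < `|f y|)%R.
    rewrite indicE memNset; last by move=> [_]; apply; split => //; exact: sQ.
    have -> : b%:E * g y = \int[mu]_(x in B) g y by rewrite integral_cst//= bE muleC.
    rewrite mule0 adde0 (_ : B = Q `&` B); last by rewrite setIidr//; exact: subDsetl.
    rewrite integral_mkcondr.
    apply: le_nonneg_integral => x Qx; first by rewrite patchE; case: ifP.
    rewrite patchE; case: ifPn => [/set_mem[_ nEx]|_]; last by rewrite lee_fin.
    rewrite gE// lee_fin.
    have fx : (`|f x| <= c)%R.
      by rewrite leNgt; apply/negP => cx; apply: nEx; split => //; exact: sQ.
    rewrite distrC (le_trans _ (lerB_dist _ _))// lerB//.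
  rewrite gE0// mule0 add0e indicE mem_set; last by split => // -[].
  rewrite mule1; apply: le_nonneg_integral => x Qx; first exact: g0.
  have fy : (`|f y| <= c)%R by rewrite leNgt; apply/negP.
  rewrite /g -EFinB ge_max !lee_fin normr_ge0 andbT.
  by rewrite (le_trans _ (lerB_dist _ _))// lerB.
apply: (@le_trans _ _ ((mu Q)^-1 * \int[mu]_(y in Q) (b%:E * g y + I * (\1_B y)%:E))); last first.
  rewrite lee_wpmul2l ?inve_ge0//; apply: le_nonneg_integral => y Qy; last exact: inner.
  by rewrite adde_ge0 ?mule_ge0 ?lee_fin// (le_trans _ b0)// divr_ge0// ltW.
have b0' : (0 <= b)%R by rewrite (le_trans _ b0)// divr_ge0// ltW.
have mind : measurable_fun (Q : set (Rn R n)) (fun y => (\1_B y)%:E : \bar R).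
  by apply/measurable_EFinP; exact: measurable_indic.
have h1 x : Q x -> 0 <= b%:E * g x by move=> _; rewrite mule_ge0.
have h2 x : Q x -> 0 <= I * (\1_B x)%:E by move=> _; rewrite mule_ge0// lee_fin.
have m1 : measurable_fun (Q : set (Rn R n)) (fun x => b%:E * g x) by exact: measurable_funeM.
have m2 : measurable_fun (Q : set (Rn R n)) (fun x => I * (\1_B x)%:E) by exact: measurable_funeM.
rewrite (ge0_integralD mu mQ h1 m1 h2 m2).
rewrite (ge0_integralZl_EFin _ mQ (fun x _ => g0 x) mg b0').
rewrite (ge0_integralZl _ mQ mind _ I0); last by move=> x _; rewrite lee_fin.
rewrite integral_indic// setIidl; last exact: subDsetl.
rewrite -/I [X in _ + _ * X](_ : _ = b%:E)// vE inver gt_eqF// (muleC I) -ge0_muleDl ?lee_fin//.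
rewrite muleA -EFinD -EFinM -[leLHS]mul1e lee_wpmul2r// lee_fin.
by rewrite ler_pdivlMl// mulr1; lra.
Qed.

(** The excess is summed over the cubes of the Calderon-Zygmund decomposition of
    the set where [|f| > c], whose total measure is at most [2 ^ n.+1 * t]. *)
Lemma GaRo_excess (C c t : R) : GaRo_bound p Q0 f C -> (0 <= C)%R -> (0 <= c)%R ->
  distribution_function Q0 f c <= t%:E -> t%:E <= (2^-1)%:E * mu Q0 ->
  \int[mu]_(x in Q0) maxe (`|f x|%:E - c%:E) 0 <=
  (C * (2 ^+ n.+1 * t) `^ p'^-1)%:E.
Proof.
move=> fC C0 c0 ct tQ0; set E := Q0 `&` [set x | (c < `|f x|)%R] in ct *.
have mQ0 := measurable_cube cQ0.
have mE : measurable (E : set (Rn R n)) by exact: measurable_abs_gt (@subset_refl _ _).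
pose g (x : Rn R n) : \bar R := maxe (`|f x|%:E - c%:E) 0.
have g0 x : 0 <= g x by rewrite /g le_max lexx orbT.
have mg : measurable_fun (Q0 : set (Rn R n)) g.
  apply: measurable_maxe; last exact: measurable_cst.
  apply: emeasurable_funB; last exact: measurable_cst.
  by apply/measurable_EFinP; apply: measurableT_comp mf; exact: normr_measurable.
have [a [l [l0 Q0E]]] := cQ0.
have EQ : E `<=` box a (a + const_mx l)%R by rewrite -Q0E; exact: subIsetl.
have smallE : mu E <= (2^-1)%:E * mu (box a (a + const_mx l)%R).
  by rewrite -Q0E (le_trans ct).
have [D [Qs [F half big null]]] := calderon_zygmund l0 EQ smallE.
rewrite -Q0E in F.
have mQ i : D i -> measurable (Qs i : set (Rn R n)).
  by move=> Di; apply: measurable_cube; exact: (F.1 i Di).1.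
set U := \bigcup_(i in D) Qs i in null.
have mU : measurable (U : set (Rn R n)) by apply: bigcup_measurable => i; exact: mQ.
have mEU : measurable (E `\` U : set (Rn R n)) by exact: measurableD.
pose G i : set (Rn R n) := if i \in D then Qs i else set0.
have mG i : measurable (G i) by rewrite /G; case: ifPn => [/set_mem/mQ|].
have mgG i : measurable_fun (Q0 : set (Rn R n)) (g \_ (G i)).
  apply/measurable_restrict => //; apply: measurable_funS mg => //.
have gG0 i x : 0 <= (g \_ (G i)) x by rewrite patchE; case: ifP.
have gU : \int[mu]_(x in Q0) g x <= \esum_(i in D) \int[mu]_(x in Qs i) g x.
  rewrite (ge0_negligible_integral mEU mQ0 mg _ null); last by move=> x _.
  apply: (@le_trans _ _ (\int[mu]_(x in Q0) \sum_(i <oo) (g \_ (G i)) x)).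
    rewrite setDE integral_mkcondr; apply: le_nonneg_integral => x Q0x.
      by rewrite patchE; case: ifP.
    rewrite patchE; case: ifPn => [/set_mem nEU|_]; last first.
      by apply: nneseries_ge0 => i _ _.
    have [[i Di Qx]|nU] := pselect (U x).
      rewrite nneseries_esumT//; apply: esum_ge; exists [set i] => //.
      by rewrite fsbig_set1 patchE mem_set// /G mem_set.
    rewrite /g max_r; first exact: nneseries_ge0.
    rewrite -EFinB lee_fin subr_le0 leNgt; apply/negP => cx.
    by apply: nEU; split => //; split.
  rewrite integral_nneseries// nneseries_esumT; last by move=> i; exact: integral_ge0.
  rewrite [leRHS]esum_mkcond; apply: le_esum => i _.
  rewrite -integral_mkcondr /G; case: ifPn => [/set_mem Di|_].
    by rewrite setIidr//; exact: (F.1 i Di).2.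
  by rewrite setI0 integral_set0.
apply: (le_trans gU).
apply: (@le_trans _ _ (\esum_(i in D) ((mu (Qs i))^-1 *
    \int[mu]_(y in Qs i) \int[mu]_(x in Qs i) `|f x - f y|%:E))).
  apply: le_esum => i Di; have [cQi sQi] := F.1 i Di.
  exact: excess_le_double_integral (half i Di).
apply: (le_trans (fC D Qs F)).
rewrite (fine_hoelder_conjugate p1 pp') EFinM lee_wpmul2l ?lee_fin// -poweR_EFin.
have p'0 : (0 < p')%R by rewrite (lt_trans ltr01)// (hoelder_conjugate_gt1 p1 pp').
have S : \esum_(i in D) mu (Qs i) <= (2 ^+ n.+1 * t)%:E.
  apply: (@le_trans _ _ (\esum_(i in D) ((2 ^+ n.+1)%:E * mu (E `&` Qs i)))).
    exact: le_esum.
  apply: (le_trans (ge0_esumZl_le _ _)) => //.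
  rewrite EFinM lee_wpmul2l ?lee_fin ?exprn_ge0//.
  apply: le_trans ct.
  apply: (le_trans (esum_lebesgue_boxes (cube_family_box F) F.2 mQ0 mE)).
  by rewrite setIidl// Q0E.
have S0 : 0 <= \esum_(i in D) mu (Qs i) by apply: esum_ge0.
apply: gt0_ler_poweR; rewrite ?in_itv/= ?leey ?andbT//.
  by rewrite invr_ge0 ltW.
exact: le_trans S.
Qed.

End excess.

(** * From Garsia-Rodemich to the weak space *)

Section GaRo_to_weak.
Context {R : realType} {n : nat}.
Variables (p p' : R) (Q0 : set 'rV[R]_n).
Hypotheses (p1 : (1 < p)%R) (pp' : (p^-1 + p'^-1 = 1)%R) (cQ0 : is_cube Q0).
Local Notation mu := (@lebesgue_Rn R n).
Local Notation mu1 := (@lebesgue_measure R).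
Variable f : Rn R n -> R.
Hypothesis fL1 : L1 Q0 f.
Local Notation fs := (rearrangement Q0 f).
Local Notation fss := (maximal_rearrangement Q0 f).

Let mQ0 : measurable (Q0 : set (Rn R n)) := measurable_cube cQ0.

Let mf : measurable_fun (Q0 : set (Rn R n)) f.
Proof. by move/measurable_int : fL1 => /measurable_EFinP. Qed.

Let p0 : (0 < p)%R. Proof. by rewrite (lt_trans ltr01). Qed.

Let p'0 : (0 < p')%R.
Proof. by rewrite (lt_trans ltr01)// (hoelder_conjugate_gt1 p1 pp'). Qed.

Let muQ0 : mu Q0 < +oo.
Proof. by have [v _ ->] := lebesgue_cube_gt0 cQ0; rewrite ltry. Qed.

Lemma measurable_rearrangement (D : set R) : measurable D -> measurable_fun D fs.
Proof.
by move=> mD; apply: nonincreasing_emeasurable => //; exact: rearrangement_noninc.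
Qed.

Lemma L1_norm_fin : L1_norm Q0 f \is a fin_num.
Proof.
rewrite ge0_fin_numE; last by apply: integral_ge0 => x _; rewrite lee_fin.
by have /integrableP[_] := fL1.
Qed.

Lemma integral_rearrangement_L1 t : (0 < t)%R ->
  \int[mu1]_(s in `[0%R, t]) fs s <= L1_norm Q0 f.
Proof.
move=> t0; apply: (le_trans (integral_rearrangement_le mQ0 mf muQ0 (lexx 0%R) t0)).
rewrite mul0r add0e; apply: le_nonneg_integral => x _; first by rewrite le_max lexx orbT.
by rewrite sube0 max_l// lee_fin.
Qed.

Lemma rearrangement_fin t : (0 < t)%R -> fs t \is a fin_num.
Proof.
move=> t0; rewrite ge0_fin_numE ?rearrangement_ge0//.
rewrite ltNge leye_eq; apply/negP => /eqP foo.
have := integral_rearrangement_L1 t0; apply/negP; rewrite -ltNge.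
apply: (@lt_le_trans _ _ (\int[mu1]_(s in `[0%R, t]) cst +oo s)).
  rewrite integral_cst//= lebesgue_measure_itv/= lte_fin t0 oppr0 adde0.
  by rewrite gt0_mulye ?lte_fin// -ge0_fin_numE ?L1_norm_fin// integral_ge0// => x _; rewrite lee_fin.
apply: le_nonneg_integral => s /=; rewrite in_itv/= => /andP[_ st]; first exact: leey.
by rewrite -foo rearrangement_noninc.
Qed.

(** The difference of the maximal function and the rearrangement is controlled
    for small [t] by the Garsia-Rodemich condition, and for large [t] by the
    norm in L^1. *)
Lemma maximal_rearrangement_sub_le (C t : R) : (0 < C)%R -> GaRo_bound p Q0 f C ->
  (0 < t)%R ->
  (t `^ p^-1)%:E * (fss t - fs t) <=
  (2 `^ (n%:R / p' + 1))%:E * C%:E +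
  ((4 / fine (mu Q0)) `^ p'^-1)%:E * L1_norm Q0 f.
Proof.
move=> C0 fC t0.
have [v v0 vE] := lebesgue_cube_gt0 cQ0.
have L0 : 0 <= L1_norm Q0 f by apply: integral_ge0 => x _; rewrite lee_fin.
have tp0 : (0 <= t `^ p^-1)%R by exact: powR_ge0.
have tppE : (t `^ p^-1 * t^-1 = t^-1 `^ p'^-1)%R.
  rewrite -(powR_inv1 (ltW t0)) -powRD; last by apply/implyP => _; rewrite gt_eqF.
  rewrite -powRrM; congr (_ `^ _)%R.
  by rewrite mulN1r -pp' opprD addrA subrr add0r.
rewrite vE/=; have [tv|tv] := leP (v / 4)%R t.
  apply: (@le_trans _ _ (((4 / v) `^ p'^-1)%:E * L1_norm Q0 f)); last first.
    by rewrite leeDr// mule_ge0// lee_fin ?powR_ge0// ltW.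
  apply: (@le_trans _ _ ((t `^ p^-1)%:E * (t^-1%:E * L1_norm Q0 f))).
    rewrite lee_wpmul2l ?lee_fin//.
    apply: (@le_trans _ _ (fss t)).
      by rewrite leeBlDr ?rearrangement_fin// leeDl// rearrangement_ge0.
    by rewrite lee_wpmul2l ?lee_fin ?invr_ge0 ?(ltW t0)// integral_rearrangement_L1.
  rewrite muleA -EFinM tppE lee_wpmul2r// lee_fin.
  apply: ge0_ler_powR; rewrite ?nnegrE ?invr_ge0 ?divr_ge0 ?(ltW t0) ?(ltW v0) ?(ltW p'0)//.
  by rewrite -[leRHS]invrK invf_div lef_pV2 ?posrE ?divr_gt0.
apply: (@le_trans _ _ ((2 `^ (n%:R / p' + 1))%:E * C%:E)); last first.
  by rewrite leeDl// mule_ge0// lee_fin powR_ge0.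
pose K := (t^-1 * (C * (2 ^+ n.+1 * t) `^ p'^-1))%R.
(* fs t is an infimum over levels c, each of which satisfies fss t <= c + K *)
have fssK : fss t - K%:E <= fs t.
  apply: le_ereal_inf_tmp => _ [c [c0 ct] <-].
  rewrite leeBlDr//.
  have H : \int[mu1]_(s in `[0%R, t]) fs s <= (c * t)%:E + (C * (2 ^+ n.+1 * t) `^ p'^-1)%:E.
    apply: (le_trans (integral_rearrangement_le mQ0 mf muQ0 c0 t0)).
    rewrite leeD2l//; apply: (GaRo_excess p1 pp' cQ0 mf fC (ltW C0) c0 ct).
    by rewrite vE -EFinM lee_fin mulrC; lra.
  apply: (@le_trans _ _ (t^-1%:E * ((c * t)%:E + (C * (2 ^+ n.+1 * t) `^ p'^-1)%:E))).
    by rewrite lee_wpmul2l ?lee_fin ?invr_ge0 ?(ltW t0).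
  rewrite -EFinD -EFinM -EFinD lee_fin mulrDr lerD2r.
  by rewrite mulrCA mulVf ?mulr1// gt_eqF.
apply: (@le_trans _ _ ((t `^ p^-1)%:E * K%:E)).
  rewrite lee_wpmul2l ?lee_fin//.
  by rewrite leeBlDr ?rearrangement_fin// addeC -leeBlDr.
rewrite -!EFinM lee_fin /K mulrA tppE mulrCA mulrC.
rewrite ler_wpM2r ?(ltW C0)//.
rewrite mulrC powRM ?exprn_ge0 ?(ltW t0)//.
rewrite -mulrA -powRM ?invr_ge0 ?(ltW t0)// mulfV ?gt_eqF// powR1 mulr1.
rewrite -powR_mulrn// -powRrM; apply: ler_powR; first by rewrite ler1n.
rewrite -natr1 mulrDl mul1r lerD2l.
by rewrite invf_le1// ltW// (hoelder_conjugate_gt1 p1 pp').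
Qed.

Lemma rearrangement_doubling t : (0 < t)%R ->
  fs t + fs (2 * t)%R <= 2%:E * fss (2 * t)%R.
Proof.
move=> t0; have t20 : (0 < 2 * t)%R by rewrite mulr_gt0.
have tt : (t <= 2 * t)%R by rewrite ler_peMl ?ler1n// ltW.
rewrite /maximal_rearrangement muleA -EFinM invfM mulrA divff// mul1r.
rewrite lee_pdivlMl//.
rewrite (_ : `[0%R, (2 * t)%R]%classic = `[0%R, t]%classic `|` `]t, (2 * t)%R]%classic); last first.
  by apply/esym; rewrite -itv_bndbnd_setU// bnd_simp// ltW.
rewrite ge0_integral_setU//; last 3 first.
- apply: measurable_rearrangement; apply: measurableU => //.
- by move=> s _; exact: rearrangement_ge0.
- rewrite disj_set2E; apply/eqP/seteqP; split => u //=; rewrite !in_itv/= => -[/andP[_ ut]].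
  by rewrite ltNge ut.
rewrite muleDr ?fin_num_adde_defl ?rearrangement_fin//.
apply: leeD.
  apply: (@le_trans _ _ (\int[mu1]_(s in `[0%R, t]) cst (fs t) s)).
    by rewrite integral_cst//= lebesgue_measure_itv/= lte_fin t0 oppr0 adde0 muleC.
  apply: le_nonneg_integral => s; first by move=> _; exact: rearrangement_ge0.
  by rewrite /= in_itv/= => /andP[_ st]; exact: rearrangement_noninc.
apply: (@le_trans _ _ (\int[mu1]_(s in `]t, (2 * t)%R]) cst (fs (2 * t)%R) s)).
  rewrite integral_cst//= lebesgue_measure_itv/= lte_fin ltr_pMl// ltr1n/= -EFinB.
  have -> : (2 * t - t = t)%R by lra.
  by rewrite [leRHS]muleC.
apply: le_nonneg_integral => s; first by move=> _; exact: rearrangement_ge0.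
by rewrite /= in_itv/= => /andP[_ st]; exact: rearrangement_noninc.
Qed.

(** With [q = 2 ^ (-1/p)], the values [phi t = t ^ (1/p) * fs t] satisfy
    [phi t <= q * phi (2 * t) + 2 * M * q], and [phi] vanishes from the measure
    of the cube on; hence [phi] is bounded by the fixed point [K] of
    [x |-> q * x + 2 * M * q]. *)
Lemma weakL_norm_lty (C : R) : (0 < C)%R -> GaRo_bound p Q0 f C ->
  weakL_norm p Q0 f < +oo.
Proof.
move=> C0 fC; have [v v0 vE] := lebesgue_cube_gt0 cQ0.
have L0 : 0 <= L1_norm Q0 f by apply: integral_ge0 => x _; rewrite lee_fin.
pose M : R := ((2 `^ (n%:R / p' + 1)) * C + (4 / fine (mu Q0)) `^ p'^-1 * fine (L1_norm Q0 f))%R.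
have M0 : (0 <= M)%R.
  by rewrite addr_ge0// mulr_ge0 ?powR_ge0 ?(ltW C0)// fine_ge0.
pose F t := fine (fs t).
have FE t : (0 < t)%R -> fs t = (F t)%:E by move=> t0; rewrite /F fineK// rearrangement_fin.
have F0 t : (0 <= F t)%R by rewrite fine_ge0// rearrangement_ge0.
pose q : R := (2^-1 `^ p^-1)%R.
have q0 : (0 < q)%R by rewrite powR_gt0.
have q1 : (q < 1)%R.
  rewrite [ltRHS](_ : _ = 1 `^ p^-1)%R; last by rewrite powR1.
  apply: gt0_ltr_powR; rewrite ?nnegrE ?invr_gt0//.
  by rewrite invf_lt1// ltr1n.
have step t : (0 < t)%R ->
    (t `^ p^-1 * F t <= q * ((2 * t) `^ p^-1 * F (2 * t)) + 2 * M * q)%R.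
  move=> t0; have t20 : (0 < 2 * t)%R by rewrite mulr_gt0.
  have fssE : fss (2 * t)%R \is a fin_num.
    rewrite fin_numM// ge0_fin_numE; last by apply: integral_ge0 => s _; exact: rearrangement_ge0.
    by rewrite (le_lt_trans (integral_rearrangement_L1 t20))// -ge0_fin_numE// L1_norm_fin.
  have := maximal_rearrangement_sub_le C0 fC t20.
  have := rearrangement_doubling t0.
  rewrite !FE// -(fineK fssE) -(fineK L1_norm_fin) -EFinB -!EFinM -!EFinD !lee_fin -/M.
  set G := fine (fss (2 * t)%R) => H1 H2.
  have tq : (t `^ p^-1 = q * (2 * t) `^ p^-1)%R.
    by rewrite -powRM ?ltW// mulrA mulVf// mul1r.
  rewrite tq -!mulrA; set w := ((2 * t) `^ p^-1)%R in H2 *.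
  have w0 : (0 <= w)%R by exact: powR_ge0.
  have -> : (q * (w * F (2 * t)%R) + 2 * (M * q) = q * (w * F (2 * t)%R + 2 * M))%R by lra.
  rewrite ler_pM2l//.
  have H3 : (w * (F t - F (2 * t)%R) <= w * (2 * (G - F (2 * t)%R)))%R.
    by rewrite ler_wpM2l//; lra.
  have aux (x a b g m : R) : (x * (g - b) <= m -> x * (a - b) <= x * (2 * (g - b)) ->
    x * a <= x * b + 2 * m)%R by move=> *; lra.
  exact: aux H2 H3.
pose K := (2 * M * q / (1 - q))%R.
have K0 : (0 <= K)%R by rewrite divr_ge0 ?mulr_ge0 ?(ltW q0)// subr_ge0 ltW.
have KE : (q * K + 2 * M * q = K)%R.
  have qn : (1 - q != 0)%R by rewrite gt_eqF// subr_gt0.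
  have <- : (K * (1 - q) = 2 * M * q)%R by rewrite /K divfK.
  by rewrite (mulrC q) -mulrDr addrC subrK mulr1.
(* induction on the number k of doublings that take t beyond the measure v *)
have bound k t : (0 < t)%R -> (v <= 2 ^+ k * t)%R -> (t `^ p^-1 * F t <= K)%R.
  elim: k t => [|k IH] t t0.
    rewrite expr0 mul1r => vt.
    have : fs t <= 0%:E.
      apply: rearrangement_le => //; apply: (le_trans (distribution_function_le mQ0 mf _)).
      by rewrite vE lee_fin.
    rewrite FE// lee_fin => Ft.
    by rewrite (le_trans _ K0)// mulr_ge0_le0// powR_ge0.
  rewrite exprSr -mulrA => vt.
  apply: (le_trans (step t t0)); rewrite -KE lerD2r ler_pM2l//.
  by apply: IH => //; rewrite mulr_gt0.
apply: (@le_lt_trans _ _ K%:E); last by rewrite ltry.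
apply: ge_ereal_sup => _ [t t0 <-].
rewrite FE// -EFinM lee_fin mulrC.
apply: (bound (Num.bound (v / t)%R)) => //.
rewrite -ler_pdivrMr// ltW//; apply: (@lt_le_trans _ _ (Num.bound (v / t))%:R).
  by rewrite archi_boundP// divr_ge0 ?ltW.
by rewrite -natrX ler_nat ltnW// ltn_expl.
Qed.

End GaRo_to_weak.

Section GaRo_weak.
Context {R : realType} {n : nat}.
Variables (p p' : R) (Q0 : set 'rV[R]_n).
Hypotheses (p1 : (1 < p)%R) (pp' : (p^-1 + p'^-1 = 1)%R) (cQ0 : is_cube Q0).
Local Notation mu := (@lebesgue_Rn R n).

Lemma weakL_norm_ge0 f : 0 <= weakL_norm p Q0 f.
Proof.
apply: (@le_trans _ _ (rearrangement Q0 f 1%R * (1 `^ p^-1)%:E)).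
  by rewrite mule_ge0 ?rearrangement_ge0// lee_fin powR_ge0.
by apply: ereal_sup_ubound; exists 1%R => //=.
Qed.

Lemma weakL_sub_GaRo f : weakL p Q0 f ->
  GaRo p Q0 f /\ GaRo_norm p Q0 f <= (2 * p / (p - 1))%:E * weakL_norm p Q0 f.
Proof.
move=> [mf Nf]; have N0 := weakL_norm_ge0 f.
have p0 : (0 < p)%R by rewrite (lt_trans ltr01).
have k0 : (0 < 2 * p / (p - 1))%R by rewrite divr_gt0 ?mulr_gt0// subr_gt0.
have fN : weakL_norm p Q0 f \is a fin_num by rewrite ge0_fin_numE.
have fN0 : (0 <= fine (weakL_norm p Q0 f))%R by exact: fine_ge0.
have pos e : (0 < e)%R -> (0 < fine (weakL_norm p Q0 f) + e)%R by move=> e0; rewrite ltr_wpDl.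
have le e : (0 < e)%R -> weakL_norm p Q0 f <= (fine (weakL_norm p Q0 f) + e)%:E.
  by move=> e0; rewrite -[leLHS]fineK// lee_fin lerDl ltW.
have H e (e0 : (0 < e)%R) := weak_GaRo_bound p1 pp' cQ0 mf (pos e e0) (le e e0).
split.
  split; first exact: (weak_L1 p1 pp' cQ0 mf (pos _ ltr01) (le _ ltr01)).
  exists (2 * p / (p - 1) * (fine (weakL_norm p Q0 f) + 1))%R; last exact: (H _ ltr01).
  by rewrite mulr_gt0// pos.
apply/lee_addgt0Pr => e e0.
have ek : (0 < e / (2 * p / (p - 1)))%R by rewrite divr_gt0.
rewrite -[in leRHS](fineK fN) -EFinM -EFinD.
rewrite (_ : _ + e = 2 * p / (p - 1) * (fine (weakL_norm p Q0 f) + e / (2 * p / (p - 1))))%R; last first.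
  by rewrite mulrDr; congr (_ + _)%R; rewrite mulrC divfK// gt_eqF.
by apply: GaRo_norm_le; [rewrite mulr_gt0// pos|exact: H].
Qed.

Lemma GaRo_sub_weakL f : GaRo p Q0 f -> weakL p Q0 f.
Proof.
move=> [fL1 [C C0 fC]]; split; first by move/measurable_int : fL1 => /measurable_EFinP.
exact: (weakL_norm_lty p1 pp' cQ0 fL1 C0 fC).
Qed.

Lemma GaRo_maximal_rearrangement f : GaRo p Q0 f ->
  ereal_sup [set (t `^ p^-1)%:E *
               (maximal_rearrangement Q0 f t - rearrangement Q0 f t)
               | t in [set t : R | (0 < t)%R]]
  <= (2 `^ (n%:R / p' + 1))%:E * GaRo_norm p Q0 f +
     ((4 / fine (mu Q0)) `^ p'^-1)%:E * L1_norm Q0 f.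
Proof.
move=> [fL1 [C C0 fC]]; apply: ge_ereal_sup => _ [t t0 <-].
have G0 : 0 <= GaRo_norm p Q0 f.
  by apply: le_ereal_inf_tmp => _ [c [c0 _] <-]; rewrite lee_fin ltW.
have fG : GaRo_norm p Q0 f \is a fin_num.
  by rewrite ge0_fin_numE// (le_lt_trans (GaRo_norm_le C0 fC))// ltry.
apply/lee_addgt0Pr => e e0.
set k : R := (2 `^ _)%R.
have k0 : (0 < k)%R by rewrite powR_gt0.
have ek : (0 < e / k)%R by rewrite divr_gt0.
have [_ [c [c0 fc] <-] cG] := lb_ereal_inf_adherent ek fG.
apply: (le_trans (maximal_rearrangement_sub_le p1 pp' cQ0 fL1 c0 fc t0)).
rewrite addeAC leeD2r//.
apply: (@le_trans _ _ (k%:E * (GaRo_norm p Q0 f + (e / k)%:E))).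
  by rewrite lee_wpmul2l// ?lee_fin ltW.
by rewrite -(fineK fG) -EFinD -!EFinM -EFinD lee_fin mulrDr mulrCA divff ?gt_eqF// mulr1.
Qed.

End GaRo_weak.

Theorem theorem5 (R : realType) (n : nat) (p p' : R) (Q0 : set 'rV[R]_n) :
  (0 < n)%N -> (1 < p)%R -> (p^-1 + p'^-1 = 1)%R -> is_cube Q0 ->
  (JN p Q0 `<=` GaRo p Q0 /\
   forall f, JN p Q0 f -> GaRo_norm p Q0 f <= 2%:E * JN_norm p Q0 f) /\
  (GaRo p Q0 = weakL p Q0 /\
   forall f, GaRo p Q0 f ->
     GaRo_norm p Q0 f <= (2 * p / (p - 1))%:E * weakL_norm p Q0 f /\
     ereal_sup [set (t `^ p^-1)%:E *
                    (maximal_rearrangement Q0 f t - rearrangement Q0 f t)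
               | t in [set t : R | (0 < t)%R]]
       <= (2 `^ (n%:R / p' + 1))%:E * GaRo_norm p Q0 f +
          ((4 / fine (lebesgue_Rn Q0)) `^ p'^-1)%:E * L1_norm Q0 f).
Proof.
move=> _ p1 pp' cQ0; split; split.
- by move=> f /(JN_sub_GaRo p1 pp' cQ0)[].
- by move=> f /(JN_sub_GaRo p1 pp' cQ0)[].
- apply/seteqP; split => f; first exact: GaRo_sub_weakL pp' cQ0 f.
  by move=> /(weakL_sub_GaRo p1 pp' cQ0)[].
- move=> f fG; split; last exact: GaRo_maximal_rearrangement.
  by have [] := weakL_sub_GaRo p1 pp' cQ0 (GaRo_sub_weakL p1 pp' cQ0 fG).
Qed.
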